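(* Let $E=\mathbb{Q}(\sqrt{-7})$ and let $\mathfrak{O}=\mathbb{Z}\left[\frac{1+\sqrt{-7}}{2}\right]$ be its ring of integers. The ternary Hermitian $\mathfrak{O}$-lattice $\langle 1,1,1\rangle$ is $2$-universal.
   Context: A Hermitian $\mathfrak{O}$-lattice is a finitely generated $\mathfrak{O}$-submodule $L$ of a finite-dimensional $E$-vector space equipped with a form $H$ that is linear in the first variable, satisfies $H(x,y)=\overline{H(y,x)}$ (bar is complex conjugation), and has $H(L,L)\subseteq\mathfrak{O}$. Its rank is $\dim_E EL$; binary means rank 2, ternary means rank 3. It is positive (definite) if $H(v):=H(v,v)>0$ for all $0\neq v\in L$. Here every lattice is free ($\mathfrak{O}$ is a PID); the Gram matrix of a lattice with basis $v_1,\dots,v_n$ is $M_L=(H(v_i,v_j))$. $\langle a_1,\dots,a_n\rangle$ denotes the free lattice with diagonal Gram matrix with entries $a_1,\dots,a_n$. $L$ represents $\ell$ if $M_\ell=XM_LX^*$ for some matrix $X$ over $\mathfrak{O}$, where $X^*$ is the conjugate transpose. A positive Hermitian $\mathfrak{O}$-lattice is $2$-universal if it represents all binary positive Hermitian $\mathfrak{O}$-lattices. *)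

(* Defs.v *)
From HB Require Import structures.
From mathcomp Require Import all_boot all_order all_algebra all_field.
From mathcomp Require Import zify ring.

Set Implicit Arguments.
Unset Strict Implicit.
Unset Printing Implicit Defensive.

Import Order.TTheory GRing.Theory Num.Theory.
Local Open Scope ring_scope.

(* E = Q(sqrt -7) is realized as a subfield of algC, so that its bar           *)
(* involution and the order used for positivity are those of the complex      *)
(* numbers.                                                                   *)

Definition sqrtm7 : algC := 'i * sqrtC 7.

Definition Qsqrtm7 : {pred algC} :=
  [pred z | ('Re z \in Crat) && ('Im z / sqrtC 7 \in Crat)].

Definition omega : algC := (1 + sqrtm7) / 2.

Lemma sqrt7_neq0 : sqrtC 7 != 0 :> algC.
Proof. by rewrite sqrtC_eq0 pnatr_eq0. Qed.

Lemma sqrt7_real : (sqrtC 7 : algC) \is Num.real.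
Proof. by apply: ger0_real; rewrite sqrtC_ge0 ler0n. Qed.

Lemma sqr_sqrtm7 : sqrtm7 ^+ 2 = - 7 :> algC.
Proof. by rewrite /sqrtm7 exprMn sqrCi sqrtCK mulN1r. Qed.

Lemma conj_sqrtm7 : (sqrtm7)^* = - sqrtm7.
Proof. by rewrite rmorphM /= conjCi (CrealP sqrt7_real) mulNr. Qed.

Lemma conj_coord (x y : rat) :
  (ratr x + ratr y * sqrtm7)^* = ratr x - ratr y * sqrtm7 :> algC.
Proof.
rewrite rmorphD (rmorphM _ (ratr y)) /= conj_sqrtm7 mulrN.
by rewrite !conj_Crat ?Crat_rat.
Qed.

Lemma Qsqrtm7P (z : algC) :
  reflect (exists x y : rat, z = ratr x + ratr y * sqrtm7) (z \in Qsqrtm7).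
Proof.
apply: (iffP andP) => [[/CratP[x hx] /CratP[y hy]]|[x [y ->]]].
  exists x, y; rewrite -hx -hy {1}[z]Crect; congr (_ + _).
  by rewrite /sqrtm7 mulrCA divfK ?sqrt7_neq0.
have xR : (ratr x : algC) \is Num.real by rewrite Creal_Crat ?Crat_rat.
have yR : (ratr y * sqrtC 7 : algC) \is Num.real.
  by rewrite realM ?sqrt7_real ?Creal_Crat ?Crat_rat.
rewrite /sqrtm7 mulrCA Re_rect ?Im_rect //.
by rewrite mulfK ?sqrt7_neq0 // !Crat_rat.
Qed.

Lemma Qsqrtm7_divring_closed : divring_closed Qsqrtm7.
Proof.
have s2 := sqr_sqrtm7.
split.
- by apply/Qsqrtm7P; exists 1, 0; rewrite rmorph1 rmorph0 mul0r addr0.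
- move=> _ _ /Qsqrtm7P[a [b ->]] /Qsqrtm7P[c [d ->]]; apply/Qsqrtm7P.
  by exists (a - c), (b - d); rewrite !rmorphB /=; ring.
move=> _ _ /Qsqrtm7P[a [b ->]] /Qsqrtm7P[c [d ->]]; apply/Qsqrtm7P.
have [->|nz] := eqVneq (ratr c + ratr d * sqrtm7 : algC) 0.
  by exists 0, 0; rewrite rmorph0 invr0 mulr0 mul0r addr0.
pose n : rat := c ^+ 2 + 7 * d ^+ 2.
have nE : ratr n = (ratr c + ratr d * sqrtm7) * (ratr c - ratr d * sqrtm7).
  rewrite /n rmorphD rmorphM !rmorphXn /= ratr_nat.
  by rewrite -[7 in LHS]opprK -s2; ring.
have n0 : (ratr n : algC) != 0.
  rewrite nE mulf_neq0 //; apply: contraNneq nz => e.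
  by rewrite -conjC_eq0 conj_coord e.
exists ((a * c + 7 * b * d) / n), ((b * c - a * d) / n).
rewrite [ratr ((_ + 7 * _ * _) / n)]fmorph_div [ratr ((_ - _) / n)]fmorph_div.
apply: (mulIf n0); rewrite [RHS]mulrDl [X in _ = _ + X]mulrAC !divfK //.
rewrite [X in _ * X = _]nE mulrA divfK // rmorphD rmorphB !rmorphM /= ratr_nat.
rewrite -[7 in RHS]opprK -s2; ring.
Qed.
HB.instance Definition _ :=
  GRing.isDivringClosed.Build algC Qsqrtm7 Qsqrtm7_divring_closed.

Record E := InE {E_val :> algC; E_valP : E_val \in Qsqrtm7}.

HB.instance Definition _ := [isSub for E_val].
HB.instance Definition _ := [Countable of E by <:].
HB.instance Definition _ := [SubChoice_isSubIntegralDomain of E by <:].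
HB.instance Definition _ := [SubIntegralDomain_isSubField of E by <:].

Lemma E_val_is_zmod_morphism : zmod_morphism E_val. Proof. by []. Qed.
Lemma E_val_is_monoid_morphism : monoid_morphism E_val. Proof. by []. Qed.
HB.instance Definition _ :=
  GRing.isZmodMorphism.Build E algC E_val E_val_is_zmod_morphism.
HB.instance Definition _ :=
  GRing.isMonoidMorphism.Build E algC E_val E_val_is_monoid_morphism.

Lemma Qsqrtm7_conj (z : algC) : z \in Qsqrtm7 -> z^* \in Qsqrtm7.
Proof.
case/Qsqrtm7P=> x [y ->]; apply/Qsqrtm7P; exists x, (- y).
by rewrite conj_coord rmorphN mulNr.
Qed.

Definition conjE (x : E) : E := InE (Qsqrtm7_conj (E_valP x)).

Lemma conjE_is_zmod_morphism : zmod_morphism conjE.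
Proof. by move=> x y; apply: val_inj; rewrite /= rmorphB. Qed.
Lemma conjE_is_monoid_morphism : monoid_morphism conjE.
Proof.
by split=> [|x y]; apply: val_inj; rewrite /= (rmorph1, rmorphM).
Qed.
HB.instance Definition _ :=
  GRing.isZmodMorphism.Build E E conjE conjE_is_zmod_morphism.
HB.instance Definition _ :=
  GRing.isMonoidMorphism.Build E E conjE conjE_is_monoid_morphism.

Lemma conjEK : involutive conjE.
Proof. by move=> x; apply: val_inj; rewrite /= conjCK. Qed.

(* The ring of integers of E; OEP below identifies it with Z[omega].          *)
Definition OE : {pred E} := [pred x : E | E_val x \in Aint].

Lemma OE_subring_closed : subring_closed OE.
Proof.
split=> [|x y xO yO|x y xO yO]; rewrite inE /=.
- exact: Aint1.
- exact: rpredB.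
- exact: rpredM.
Qed.
HB.instance Definition _ := GRing.isSubringClosed.Build E OE OE_subring_closed.

Lemma OE_conj (x : E) : x \in OE -> conjE x \in OE.
Proof. by rewrite !inE /= => xO; rewrite Aint_aut. Qed.

Lemma omega_Aint : omega \in Aint.
Proof.
have h : omega ^+ 2 - omega + 2 = 0.
  have -> : omega ^+ 2 - omega + 2 = (sqrtm7 ^+ 2 + 7) / 4.
    by rewrite /omega; field.
  by rewrite sqr_sqrtm7 addNr mul0r.
apply: (@root_monic_Aint ('X^2 - 'X + 2%:P)).
- by rewrite rootE !hornerD hornerN hornerXn hornerX hornerC h.
- rewrite monicE -addrA lead_coefDl ?lead_coefXn // size_polyXn ltnS.
  rewrite (leq_trans (size_polyD _ _)) // size_polyN size_polyX geq_max /=.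
  by rewrite (leq_trans (size_polyC_leq1 _)).
- apply/polyOverP => i; rewrite !coefE.
  apply/intrP; exists ((i == 2%N)%:R - (i == 1)%:R + (if i == 0 then 2 else 0)).
  by rewrite rmorphD rmorphB !rmorph_nat; case: ifP => _; rewrite ?rmorph_nat ?rmorph0.
Qed.

Lemma ratr_intP (q : rat) :
  (ratr q : algC) \in Num.int -> exists m : int, q = m%:~R.
Proof.
case/intrP=> m; rewrite -(ratr_int algC m) => /fmorph_inj ->.
by exists m.
Qed.

Lemma OEP (x : E) :
  reflect (exists a b : int, E_val x = a%:~R + b%:~R * omega) (x \in OE).
Proof.
apply: (iffP idP) => [|[a [b e]]]; last first.
  rewrite inE /= e; apply: rpredD; first exact: Aint_int.
  by apply: rpredM; [exact: Aint_int | exact: omega_Aint].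
rewrite inE /=; case: x => z0 /= /Qsqrtm7P[r [s ->]] zA.
set z := _ + _ in zA *.
have zcA : z^* \in Aint by rewrite Aint_aut.
have zcE : z^* = ratr r - ratr s * sqrtm7.
  exact: conj_coord.
have trI : (ratr (2 * r) : algC) \in Num.int.
  apply: Cint_rat_Aint; first exact: Crat_rat.
  have -> : ratr (2 * r) = z + z^*.
    by rewrite zcE /z rmorphM /= ratr_nat; ring.
  exact: rpredD.
have nI : (ratr (r ^+ 2 + 7 * s ^+ 2) : algC) \in Num.int.
  apply: Cint_rat_Aint; first exact: Crat_rat.
  have -> : ratr (r ^+ 2 + 7 * s ^+ 2) = z * z^*.
    rewrite zcE /z rmorphD rmorphM !rmorphXn /= ratr_nat.
    by rewrite -[7 in LHS]opprK -sqr_sqrtm7; ring.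
  exact: rpredM.
have sI : (ratr (14 * s) : algC) \in Num.int.
  apply: Cint_rat_Aint; first exact: Crat_rat.
  have -> : ratr (14 * s) = (z^* - z) * (2 * omega - 1).
    have -> : 2 * omega - 1 = sqrtm7 by rewrite /omega; field.
    have -> : (z^* - z) * sqrtm7 = - (2 * ratr s) * sqrtm7 ^+ 2.
      by rewrite zcE /z; ring.
    by rewrite sqr_sqrtm7 rmorphM /= ratr_nat; ring.
  apply: rpredM; first exact: rpredB.
  apply: rpredB; last exact: Aint1.
  by apply: rpredM; [exact: (Aint_int 2) | exact: omega_Aint].
have [m hm] := ratr_intP trI; have [u hu] := ratr_intP sI.
have [n hn] := ratr_intP nI.
have hr : r = m%:~R / 2 by rewrite -hm; field.
have hs : s = u%:~R / 14 by rewrite -hu; field.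
have e1 : u ^+ 2 = 7 * (4 * n - m ^+ 2).
  apply: (@intr_inj rat); rewrite !(rmorphXn, intrM, rmorphB) /=.
  by rewrite (rmorphM _ 4 n) /= -hn hr hs; field.
have [v hv] : exists v, u = 7 * v.
  have /dvdzP[v hv] : (7 %| u)%Z.
    have : (7 %| u ^+ 2)%Z by rewrite e1 dvdz_mulr.
    by rewrite !dvdzE abszX Euclid_dvdX // andbT.
  by exists v; rewrite mulrC.
have e2 : 7 * v ^+ 2 = 4 * n - m ^+ 2 by lia.
have [a ha] : exists a, m = 2 * a + v.
  have [a [->|hm2]] : exists a, m = 2 * a + v \/ m = 2 * a + v + 1.
      exists ((m - v) %/ 2)%Z; have := divz_eq (m - v) 2.
      by have := @modz_ge0 (m - v) 2 isT; have := @ltz_pmod (m - v) 2 isT; lia.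
    by exists a.
  by exfalso; move: e2; rewrite hm2; clear; lia.
have hr' : r = a%:~R + v%:~R / 2.
  by rewrite hr ha rmorphD (rmorphM _ 2 a) /=; field.
have hs' : s = v%:~R / 2 by rewrite hs hv (rmorphM _ 7 v) /=; field.
exists a, v; rewrite /z hr' hs' /omega.
have q2 (k : int) : ratr (k%:~R / 2) = k%:~R / 2 :> algC.
  by rewrite [LHS]fmorph_div; congr (_ / _); rewrite [LHS](ratr_int, ratr_nat).
by rewrite [ratr (_ + _)]rmorphD [X in X + _ + _]ratr_int !q2; field.
Qed.

(* The O-submodule generated by the family s.                                 *)
Definition Ospan (V : lmodType E) (s : seq V) (x : V) : Prop :=
  exists2 c : 'I_(size s) -> E,
    forall i, c i \in OE & x = \sum_i c i *: s`_i.

Definition Oindependent (V : lmodType E) (s : seq V) : Prop :=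
  forall c : 'I_(size s) -> E,
    (forall i, c i \in OE) -> \sum_i c i *: s`_i = 0 -> forall i, c i = 0.

(* Finite generation of the O-module is built in: a lattice is the span of a  *)
(* chosen finite generating family, which need not be a basis.                *)
Record hlattice := HLattice {
  ambient : vectType E;
  hform : {hermitian_sym ambient for conjE};
  gens : seq ambient;
  hform_integral : forall x y : ambient,
    Ospan gens x -> Ospan gens y -> hform x y \in OE
}.

Definition in_lattice (L : hlattice) : ambient L -> Prop := Ospan (gens L).

(* <<gens L>> is the E-subspace EL.                                           *)
Definition lrank (L : hlattice) : nat := \dim <<gens L>>.

(* 0 < z in algC says that z is real and positive.                            *)
Definition positive_lattice (L : hlattice) : Prop :=
  forall v : ambient L, in_lattice v -> v != 0 -> 0 < E_val (hform L v v).

Definition lattice_basis (L : hlattice) (v : seq (ambient L)) : Prop :=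
  Oindependent v /\ (forall x, Ospan v x <-> in_lattice x).

Definition gram (L : hlattice) (v : seq (ambient L)) : 'M[E]_(size v) :=
  \matrix_(i, j) hform L v`_i v`_j.

(* The choice of bases is immaterial: another one multiplies X by invertible  *)
(* matrices over O.  Bases exist because O is a principal ideal domain.       *)
Definition represents (L l : hlattice) : Prop :=
  exists (v : seq (ambient L)) (w : seq (ambient l))
         (X : 'M[E]_(size w, size v)),
    [/\ lattice_basis v, lattice_basis w, X \is a mxOver OE &
        gram w = X *m gram v *m map_mx conjE X^T].

Definition two_universal (L : hlattice) : Prop :=
  positive_lattice L /\
  forall l : hlattice, lrank l = 2%N -> positive_lattice l -> represents L l.

(* The lattice <a_1, ..., a_n>.  Diagonal Gram entries lie in O and are fixed *)
(* by conjugation, hence are rational integers.                               *)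
Section DiagonalLattice.
Variable a : seq int.
Let n := size a.

Definition diag_gram : 'M[E]_n := diag_mx (\row_(i < n) (a`_i)%:~R).

Definition diag_form : 'rV[E]_n -> 'rV[E]_n -> E := form conjE diag_gram.

Definition diag_gens : seq 'rV[E]_n := [seq delta_mx 0 i | i <- enum 'I_n].

Lemma diag_formE x y :
  diag_form x y = \sum_(i < n) (a`_i)%:~R * x 0 i * conjE (y 0 i).
Proof.
rewrite /diag_form /form mul_mx_diag mxE; apply: eq_bigr => i _.
by rewrite !mxE [x 0 i * _]mulrC.
Qed.

Lemma diag_form_bilinear :
  bilinear_for (GRing.Scale.Law.clone _ _ *%R _)
    (GRing.Scale.Law.clone _ _ (conjE \; *%R) _) diag_form.
Proof.
split=> [u'|u] k x y /=; rewrite /diag_form.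
- by rewrite formDl formZl.
- by rewrite formDr formZr.
Qed.
HB.instance Definition _ :=
  bilinear_isBilinear.Build E 'rV[E]_n 'rV[E]_n E _ _ diag_form
    diag_form_bilinear.

Lemma diag_form_hermitian x y :
  diag_form x y = (-1) ^+ false * conjE (diag_form y x).
Proof.
rewrite mul1r !diag_formE rmorph_sum; apply: eq_bigr => i _.
by rewrite !rmorphM /= conjEK rmorph_int mulrAC.
Qed.
HB.instance Definition _ :=
  isHermitianSesquilinear.Build E 'rV[E]_n false conjE diag_form
    diag_form_hermitian.

Lemma size_diag_gens : size diag_gens = n.
Proof. by rewrite size_map size_enum_ord. Qed.

Lemma diag_gens_nth (i : 'I_n) : diag_gens`_i = delta_mx 0 i.
Proof. by rewrite (nth_map i) ?size_enum_ord // nth_ord_enum. Qed.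

Lemma Ospan_diag_gens x :
  Ospan diag_gens x <-> forall i, x 0 i \in OE.
Proof.
split=> [[c cO ->] i|xO].
  rewrite summxE rpred_sum // => j _; rewrite mxE rpredM //.
  by rewrite (diag_gens_nth (cast_ord size_diag_gens j)) mxE rpred_nat.
exists (fun i => x 0 (cast_ord size_diag_gens i)) => //.
rewrite {1}[x]row_sum_delta (reindex (cast_ord size_diag_gens)) /=; last first.
  by exists (cast_ord (esym size_diag_gens)) => i _; rewrite ?cast_ordK ?cast_ordKV.
by apply: eq_bigr => i _; rewrite -diag_gens_nth.
Qed.

Lemma diag_form_integral x y :
  Ospan diag_gens x -> Ospan diag_gens y -> diag_form x y \in OE.
Proof.
move=> /Ospan_diag_gens xO /Ospan_diag_gens yO; rewrite diag_formE.
by rewrite rpred_sum // => i _; rewrite !rpredM ?rpred_int ?OE_conj.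
Qed.

Definition diag_lattice : hlattice := HLattice diag_form_integral.

Lemma diag_lattice_basis : @lattice_basis diag_lattice diag_gens.
Proof.
split=> // c _ c0 i; pose j := cast_ord size_diag_gens i.
have /rowP/(_ j) := c0; rewrite !mxE summxE (bigD1 i) //= big1 => [|k ki].
  by rewrite (diag_gens_nth j) !mxE !eqxx mulr1 addr0.
rewrite (diag_gens_nth (cast_ord size_diag_gens k)) !mxE /= -val_eqE /=.
have -> : (i == k :> nat) = false by apply: contraNF ki => /eqP e; apply/eqP/val_inj.
by rewrite mulr0.
Qed.

Lemma gram_diag_gens (i j : 'I_n) :
  let c := cast_ord (esym size_diag_gens) in
  @gram diag_lattice diag_gens (c i) (c j) = (a`_i)%:~R *+ (i == j).
Proof.
rewrite /= mxE !diag_gens_nth /= /diag_form formee.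
by rewrite /diag_gram !mxE.
Qed.

Lemma lrank_diag_lattice : lrank diag_lattice = n.
Proof.
transitivity (\dim {: 'rV[E]_n}); last first.
  by rewrite dimvf dim_matrix; apply: mul1n.
rewrite /lrank /=; congr (\dim _).
apply/vspaceP => x; rewrite memvf [x]row_sum_delta.
apply: rpred_sum => i _; apply: rpredZ; apply: memv_span.
by apply/mapP; exists i; rewrite ?mem_enum.
Qed.

End DiagonalLattice.

(* Main.v *)
Require Import Defs.
From mathcomp Require Import all_boot all_order all_algebra.
From HB Require Import structures.
From mathcomp Require Import all_field zify ring.

(** Let [O] be the ring of integers of [Q(sqrt -7)] and [I] the lattice
    [<1, 1, 1>].  A binary positive lattice [l] embeds in [I] in three steps.

    Local step ([positive2_unimodular]).  The lattice [l] lies in some positive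
    ternary lattice of determinant 1.  Enlarging [l] while it stays integral
    lowers its determinant [D], and this is possible whenever 7 or the square of
    a prime divides [D] ([refinable7], [refinable_sq]).  When [D] is squarefree
    and prime to 7, a third basis vector giving determinant 1 exists provided
    that the adjoint form of [l] takes the value -1 modulo [D]; this is solved
    modulo each prime, where the norm is surjective ([qnorm_surjective_mod]),
    and then by the Chinese remainder theorem ([adjoint_form_squarefree]).

    Reduction ([unimodular_reduction]).  [O] is Euclidean with covering radius
    [sqrt (4/7)] ([rounding]), so Hermite reduction gives a positive ternary
    lattice of determinant 1 a nonzero vector of norm at most 7/3.  If the norm
    is 1 the lattice is [I]; if the minimum is 2, the Gram matrix is determined
    up to a change of basis and the lattice is the Klein lattice [K].

    Klein lattice ([klein_section]).  [K] does not embed in [I], but each of its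
    seven sublattices cut out by a linear form modulo the prime [omega] of
    norm 2 does: they are permuted cyclically by an isometry of [K] of order 7,
    and one of them is embedded explicitly ([hyperplane_mx_rep]).  A sublattice
    of rank 2 of [K] has an image of dimension at most 2 in the
    three-dimensional space [K / omega K], hence lies in one of the seven.

    Lattices are given by finitely many generators, so a basis is first
    extracted by the Euclidean algorithm ([Obasis_exists]). *)

Set Implicit Arguments.
Unset Strict Implicit.
Unset Printing Implicit Defensive.
Import Order.TTheory GRing.Theory Num.Theory.

Local Open Scope ring_scope.

(** * The ring of integers with integer coordinates *)

(** [Quad a b] is [a + b * omega], where [omega ^ 2 = omega - 2].  Integer
    coordinates turn every identity between explicit elements or matrices into
    polynomial identities over the integers. *)
Record quad := Quad { qre : int; qim : int }.

Definition pair_of_quad (x : quad) := (qre x, qim x).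
Definition quad_of_pair (p : int * int) := Quad p.1 p.2.
Lemma pair_of_quadK : cancel pair_of_quad quad_of_pair. Proof. by case. Qed.

HB.instance Definition _ := Choice.copy quad (can_type pair_of_quadK).

Definition quad_add x y := Quad (qre x + qre y) (qim x + qim y).
Definition quad_opp x := Quad (- qre x) (- qim x).
Definition quad_mul x y :=
  Quad (qre x * qre y - 2 * qim x * qim y)
       (qre x * qim y + qim x * qre y + qim x * qim y).

Lemma quad_addA : associative quad_add.
Proof. by move=> x y z; congr Quad; apply: addrA. Qed.
Lemma quad_addC : commutative quad_add.
Proof. by move=> x y; congr Quad; apply: addrC. Qed.
Lemma quad_add0 : left_id (Quad 0 0) quad_add.
Proof. by case=> a b; congr Quad; apply: add0r. Qed.
Lemma quad_addN : left_inverse (Quad 0 0) quad_opp quad_add.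
Proof. by move=> x; congr Quad; apply: addNr. Qed.
HB.instance Definition _ :=
  GRing.isZmodule.Build quad quad_addA quad_addC quad_add0 quad_addN.

Lemma quad_mulA : associative quad_mul.
Proof. by move=> x y z; congr Quad; rewrite /=; ring. Qed.
Lemma quad_mulC : commutative quad_mul.
Proof. by move=> x y; congr Quad; rewrite /=; ring. Qed.
Lemma quad_mul1 : left_id (Quad 1 0) quad_mul.
Proof. by case=> a b; congr Quad; rewrite /=; ring. Qed.
Lemma quad_mulDl : left_distributive quad_mul quad_add.
Proof. by move=> x y z; congr Quad; rewrite /=; ring. Qed.
Lemma quad_oner_neq0 : Quad 1 0 != 0. Proof. by []. Qed.
HB.instance Definition _ :=
  GRing.Zmodule_isComNzRing.Build quad
    quad_mulA quad_mulC quad_mul1 quad_mulDl quad_oner_neq0.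

Lemma quad_intr n : n%:~R = Quad n 0.
Proof.
have nat_case k : k%:R = Quad k%:Z 0.
  by elim: k => // k IHk; rewrite mulrS IHk; congr Quad; rewrite /= ?intS.
case: n => k; rewrite ?NegzE ?mulrNz.
  exact: nat_case.
by rewrite [X in - X](nat_case k.+1).
Qed.

Definition qomega : quad := Quad 0 1.
Definition qconj (x : quad) := Quad (qre x + qim x) (- qim x).

Lemma qconj_is_zmod_morphism : zmod_morphism qconj.
Proof. by move=> x y; congr Quad; rewrite /=; ring. Qed.
Lemma qconj_is_monoid_morphism : monoid_morphism qconj.
Proof. by split=> // x y; congr Quad; rewrite /=; ring. Qed.
HB.instance Definition _ :=
  GRing.isZmodMorphism.Build quad quad qconj qconj_is_zmod_morphism.
HB.instance Definition _ :=
  GRing.isMonoidMorphism.Build quad quad qconj qconj_is_monoid_morphism.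

Lemma qconjK : involutive qconj.
Proof. by case=> a b; congr Quad; rewrite /=; ring. Qed.

Definition qnorm (x : quad) : int := qre x ^+ 2 + qre x * qim x + 2 * qim x ^+ 2.
Definition qtrace (x : quad) : int := 2 * qre x + qim x.

Lemma quadP x y : qre x = qre y -> qim x = qim y -> x = y.
Proof. by case: x y => [a b] [c d] /= -> ->. Qed.

Ltac quad_simpl := rewrite /= /qnorm /qtrace /qconj /= ?quad_intr /=.
Ltac quad_ring := apply: quadP; quad_simpl; ring.

Lemma mul_qconj x : x * qconj x = (qnorm x)%:~R.
Proof. by quad_ring. Qed.

Lemma qnormM : {morph qnorm : x y / x * y}.
Proof. by move=> x y; rewrite /qnorm /=; ring. Qed.

Lemma qnorm_ge0 x : 0 <= qnorm x.
Proof. by rewrite /qnorm; nia. Qed.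

Lemma qnorm_eq0 x : (qnorm x == 0) = (x == 0).
Proof.
apply/eqP/eqP => [|->//]; case: x => a b; rewrite /qnorm /= => h.
have b0 : b = 0 by nia.
by congr Quad; nia.
Qed.

(** With [s] and [t] the coordinates of a point along 1 and along the orthogonal
    direction, [s ^ 2 + 7 t ^ 2] is four times its norm.  Being convex, it is
    largest at a vertex of the quadrilateral [0 <= s <= n], [0 <= t],
    [s + 7 t <= 4 n], a quarter of the Voronoi cell; the vertices
    [(0, 4n/7)] and [(n, 3n/7)] attain the bound. *)
Lemma voronoi_bound (n s t : int) : 0 <= s <= n -> 0 <= t -> s + 7 * t <= 4 * n ->
  7 * (s ^+ 2 + 7 * t ^+ 2) <= 16 * n ^+ 2.
Proof.
move=> /andP[s0 sn] t0 st.
have h : (7 * t) ^+ 2 <= (4 * n - s) ^+ 2 by nia.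
have h2 : 0 <= s * (n - s) by nia.
nia.
Qed.

(** The circumradius of the triangle 0, 1, omega has square 4/7, and this is the
    covering radius of the ring of integers in the plane. *)
Lemma rounding (n : int) (x : quad) : 0 < n ->
  exists q, 7 * qnorm (x - n%:~R * q) <= 4 * n ^+ 2.
Proof.
case: x => a b n0.
pose v := (b %/ n)%Z; pose B := b - n * v.
pose u := ((2 * a + B + n) %/ (2 * n))%Z; pose A := a - n * u.
have B0 : 0 <= B < n.
  have := divz_eq b n; have := @modz_ge0 b n; have := @ltz_pmod b n n0.
  by rewrite /B /v; lia.
have S0 : - n <= 2 * A + B < n.
  have n20 : 0 < 2 * n by lia.
  have := divz_eq (2 * a + B + n) (2 * n).
  have := @modz_ge0 (2 * a + B + n) (2 * n).
  have := @ltz_pmod (2 * a + B + n) (2 * n) n20.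
  by rewrite /A -/u; lia.
have normE i j : qnorm (Quad a b - n%:~R * Quad (u + i) (v + j))
    = qnorm (Quad (A - n * i) (B - n * j)).
  by congr qnorm; apply: quadP; rewrite quad_intr /A /B /=; ring.
have norm4 c d : 4 * qnorm (Quad c d) = (2 * c + d) ^+ 2 + 7 * d ^+ 2.
  by rewrite /qnorm /=; ring.
(* The point lies between two rows of lattice points; a half-turn about the
   centre of a lattice parallelogram exchanges the rows, and one of them
   brings the point into the quadrilateral of [voronoi_bound]. *)
have [hS|hS] := lerP 0 (2 * A + B).
  have [h|h] := lerP (2 * A + B + 7 * B) (4 * n).
    exists (Quad (u + 0) (v + 0)); rewrite normE; have := norm4 (A - n * 0) (B - n * 0).
    have := @voronoi_bound n (2 * A + B) B; rewrite !mulr0 !subr0; lia.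
  exists (Quad (u + 0) (v + 1)); rewrite normE; have := norm4 (A - n * 0) (B - n * 1).
  have := @voronoi_bound n (n - (2 * A + B)) (n - B); rewrite !mulr0 !mulr1 !subr0.
  lia.
have [h|h] := lerP (- (2 * A + B) + 7 * B) (4 * n).
  exists (Quad (u + 0) (v + 0)); rewrite normE; have := norm4 (A - n * 0) (B - n * 0).
  have := @voronoi_bound n (- (2 * A + B)) B; rewrite !mulr0 !subr0; lia.
exists (Quad (u - 1) (v + 1)); rewrite normE; have := norm4 (A - n * -1) (B - n * 1).
have := @voronoi_bound n (n + (2 * A + B)) (n - B); rewrite !mulrN !mulr1 !opprK.
lia.
Qed.

(** * Representations between Gram matrices *)

Definition adj m n (X : 'M[quad]_(m, n)) : 'M_(n, m) := (map_mx qconj X)^T.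

Lemma adjM m n p (X : 'M_(m, n)) (Y : 'M_(n, p)) : adj (X *m Y) = adj Y *m adj X.
Proof. by rewrite /adj map_mxM trmx_mul. Qed.

Definition represented m n (A : 'M[quad]_m) (B : 'M[quad]_n) :=
  exists X : 'M_(m, n), A = X *m B *m adj X.

Lemma represented_trans m n p (B : 'M_n) (A : 'M_m) (C : 'M_p) :
  represented A B -> represented B C -> represented A C.
Proof.
by move=> [X ->] [Y ->]; exists (X *m Y); rewrite adjM !mulmxA.
Qed.

Lemma represented_refl n (A : 'M_n) : represented A A.
Proof.
by exists 1%:M; rewrite mul1mx /adj map_mx1 trmx1 mulmx1.
Qed.

Definition mx_of_rows m n (s : seq (seq quad)) : 'M[quad]_(m, n) :=
  \matrix_(i, j) nth 0 (nth [::] s i) j.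

(** Decides an identity between products of explicit matrices of size at most 3. *)
Ltac mx_ring :=
  apply/matrixP; case=> [[|[|[|//]]] ?] [[|[|[|//]]] ?] //;
  rewrite /= !(mxE, big_ord_recl, big_ord0) /=; quad_ring.

(** * Change of basis in ternary lattices *)

(** Diagonal and upper entries of the Gram matrix of a basis [e1, e2, e3]. *)
Record ternary := Ternary
  { t11 : int; t22 : int; t33 : int; t12 : quad; t13 : quad; t23 : quad }.

Definition gram3 t := mx_of_rows 3 3
  [:: [:: (t11 t)%:~R; t12 t; t13 t];
      [:: qconj (t12 t); (t22 t)%:~R; t23 t];
      [:: qconj (t13 t); qconj (t23 t); (t33 t)%:~R]].

(** [minor12], [minor13] and [cominor] are [t11] times the entries of the Gram
    matrix of the projections of [e2] and [e3] to the orthogonal complement of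
    [e1]: Hermite reduction works with this binary form. *)
Definition minor12 t := t11 t * t22 t - qnorm (t12 t).
Definition minor13 t := t11 t * t33 t - qnorm (t13 t).
Definition cominor t := (t11 t)%:~R * t23 t - qconj (t12 t) * t13 t.

Definition det3 t := t11 t * t22 t * t33 t + qtrace (t12 t * t23 t * qconj (t13 t))
  - t11 t * qnorm (t23 t) - t22 t * qnorm (t13 t) - t33 t * qnorm (t12 t).

Lemma det3E t : minor12 t * minor13 t - qnorm (cominor t) = t11 t * det3 t.
Proof.
case: t => a c f [b1 b2] [d1 d2] [e1 e2].
rewrite /minor12 /minor13 /cominor /det3 quad_intr /qtrace /qnorm /qconj /=; ring.
Qed.

Definition unimodular3 t := [/\ 0 < t11 t, 0 < minor12 t & det3 t = 1].

(** [swap12] exchanges [e1] and [e2], and [shear21 q] replaces [e2] by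
    [e2 + q e1]; likewise for the other indices. *)
Definition swap12 t :=
  Ternary (t22 t) (t11 t) (t33 t) (qconj (t12 t)) (t23 t) (t13 t).
Definition swap23 t :=
  Ternary (t11 t) (t33 t) (t22 t) (t13 t) (t12 t) (qconj (t23 t)).
Definition shear21 q t :=
  Ternary (t11 t) (t22 t + qtrace (q * t12 t) + qnorm q * t11 t) (t33 t)
    (t12 t + qconj q * (t11 t)%:~R) (t13 t) (t23 t + q * t13 t).
Definition shear31 q t := swap23 (shear21 q (swap23 t)).
Definition shear32 q t :=
  Ternary (t11 t) (t22 t) (t33 t + qtrace (q * t23 t) + qnorm q * t22 t)
    (t12 t) (t13 t + qconj q * t12 t) (t23 t + qconj q * (t22 t)%:~R).

Lemma swap12_rep t : represented (gram3 t) (gram3 (swap12 t)).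
Proof.
case: t => a c f [b1 b2] [d1 d2] [e1 e2].
exists (mx_of_rows 3 3 [:: [:: 0; 1; 0]; [:: 1; 0; 0]; [:: 0; 0; 1]]).
mx_ring.
Qed.

Lemma swap23_rep t : represented (gram3 t) (gram3 (swap23 t)).
Proof.
case: t => a c f [b1 b2] [d1 d2] [e1 e2].
exists (mx_of_rows 3 3 [:: [:: 1; 0; 0]; [:: 0; 0; 1]; [:: 0; 1; 0]]).
mx_ring.
Qed.

Lemma shear21_rep q t : represented (gram3 t) (gram3 (shear21 q t)).
Proof.
case: t q => a c f [b1 b2] [d1 d2] [e1 e2] [q1 q2].
exists (mx_of_rows 3 3 [:: [:: 1; 0; 0]; [:: - Quad q1 q2; 1; 0]; [:: 0; 0; 1]]).
mx_ring.
Qed.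

Lemma shear32_rep q t : represented (gram3 t) (gram3 (shear32 q t)).
Proof.
case: t q => a c f [b1 b2] [d1 d2] [e1 e2] [q1 q2].
exists (mx_of_rows 3 3 [:: [:: 1; 0; 0]; [:: 0; 1; 0]; [:: 0; - Quad q1 q2; 1]]).
mx_ring.
Qed.

Lemma shear31_rep q t : represented (gram3 t) (gram3 (shear31 q t)).
Proof.
apply: represented_trans (swap23_rep _) _.
exact: represented_trans (shear21_rep q _) (swap23_rep _).
Qed.

(** Adding a multiple of [e1] to [e2] changes no projection, whereas adding one
    of [e2] to [e3] translates [cominor] by a multiple of [minor12]: these are
    the two rounding steps of the reduction. *)
Lemma shear21_invariants q t :
  [/\ minor12 (shear21 q t) = minor12 t, minor13 (shear21 q t) = minor13 t,
      cominor (shear21 q t) = cominor t & det3 (shear21 q t) = det3 t].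
Proof.
case: t q => a c f [b1 b2] [d1 d2] [e1 e2] [q1 q2].
split; [ | | apply: quadP | ];
  rewrite /minor12 /minor13 /cominor /det3; quad_simpl; ring.
Qed.

Lemma shear32_invariants q t :
  [/\ minor12 (shear32 q t) = minor12 t, det3 (shear32 q t) = det3 t
    & cominor (shear32 q t) = cominor t + qconj q * (minor12 t)%:~R].
Proof.
case: t q => a c f [b1 b2] [d1 d2] [e1 e2] [q1 q2].
split; [ | | apply: quadP];
  rewrite /minor12 /cominor /det3; quad_simpl; ring.
Qed.

Lemma swap12_invariants t :
  minor12 (swap12 t) = minor12 t /\ det3 (swap12 t) = det3 t.
Proof.
case: t => a c f [b1 b2] [d1 d2] [e1 e2].
by split; rewrite /minor12 /det3; quad_simpl; ring.
Qed.

Lemma swap23_invariants t :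
  [/\ minor12 (swap23 t) = minor13 t, minor13 (swap23 t) = minor12 t,
      cominor (swap23 t) = qconj (cominor t) & det3 (swap23 t) = det3 t].
Proof.
case: t => a c f [b1 b2] [d1 d2] [e1 e2].
split; [ by [] | by [] | apply: quadP | ];
  rewrite /cominor /det3; quad_simpl; ring.
Qed.

Lemma shear31_invariants q t :
  [/\ minor12 (shear31 q t) = minor12 t, minor13 (shear31 q t) = minor13 t,
      cominor (shear31 q t) = cominor t & det3 (shear31 q t) = det3 t].
Proof.
rewrite /shear31; have [-> -> -> ->] := swap23_invariants (shear21 q (swap23 t)).
have [-> -> -> ->] := shear21_invariants q (swap23 t).
by have [-> -> -> ->] := swap23_invariants t; rewrite qconjK.
Qed.

Lemma minor13_gt0 t : unimodular3 t -> 0 < minor13 t.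
Proof.
case=> a0 D0 det1; have := det3E t; rewrite det1.
have := qnorm_ge0 (cominor t); nia.
Qed.

Lemma unimodular_swap12 t : unimodular3 t -> unimodular3 (swap12 t).
Proof.
case=> a0 D0 det1; have [D det] := swap12_invariants t.
split; rewrite ?D ?det //=; move: D0; have := qnorm_ge0 (t12 t); rewrite /minor12.
nia.
Qed.

Lemma unimodular_swap23 t : unimodular3 t -> unimodular3 (swap23 t).
Proof.
move=> ut; have [D _ _ det] := swap23_invariants t; case: (ut) => a0 _ det1.
by split; rewrite ?D ?det //; apply: minor13_gt0.
Qed.

Lemma unimodular_shear21 q t : unimodular3 t -> unimodular3 (shear21 q t).
Proof.
by case=> a0 D0 det1; have [D _ _ det] := shear21_invariants q t; split; rewrite ?D ?det.
Qed.

Lemma unimodular_shear31 q t : unimodular3 t -> unimodular3 (shear31 q t).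
Proof.
by move=> ut; apply/unimodular_swap23/unimodular_shear21/unimodular_swap23.
Qed.

Lemma unimodular_shear32 q t : unimodular3 t -> unimodular3 (shear32 q t).
Proof.
by case=> a0 D0 det1; have [D det _] := shear32_invariants q t; split; rewrite ?D ?det.
Qed.

(** * Classification of the unimodular ternary lattices *)

(** The Gram-Schmidt process has nothing to divide by, so that the triangular
    factor is integral. *)
Lemma cholesky_rep t : t11 t = 1 -> minor12 t = 1 -> det3 t = 1 ->
  represented (gram3 t) (1%:M : 'M_3).
Proof.
move=> a1 D1 det1; have := det3E t; move: D1 det1.
case: t a1 => a c f [b1 b2] [d1 d2] [e1 e2] /= ->.
rewrite /minor12 /minor13 /= => cE ->; rewrite cE mul1r mulr1 => fE.
have {cE}-> : c = 1 + qnorm (Quad b1 b2) by lia.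
have {fE}-> : f = 1 + qnorm (Quad d1 d2)
   + qnorm (cominor (Ternary 1 c f (Quad b1 b2) (Quad d1 d2) (Quad e1 e2))) by lia.
exists (mx_of_rows 3 3 [:: [:: 1; 0; 0]; [:: qconj (Quad b1 b2); 1; 0];
  [:: qconj (Quad d1 d2); qconj (Quad e1 e2 - qconj (Quad b1 b2) * Quad d1 d2); 1]]).
rewrite /cominor mulmx1 mul1r /=.
mx_ring.
Qed.

Definition residues2 := [:: 0; 1; qomega; qconj qomega].

Lemma residue_mod2 x : exists q, x - q * 2%:~R \in residues2.
Proof.
case: x => a b; pose r := (a %% 2)%Z; pose s := (b %% 2)%Z.
have [ra rs] : (r = 0 \/ r = 1) /\ (s = 0 \/ s = 1) by rewrite /r /s; lia.
have := divz_eq a 2; have := divz_eq b 2; rewrite -/r -/s => bE aE.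
have h i j : Quad a b - Quad ((a %/ 2)%Z + i) ((b %/ 2)%Z + j) * 2%:~R
    = Quad (r - 2 * i) (s - 2 * j).
  by apply: quadP; rewrite quad_intr /=; lia.
case: ra rs => [r0|r1] [s0|s1].
- by exists (Quad ((a %/ 2)%Z + 0) ((b %/ 2)%Z + 0)); rewrite h r0 s0.
- by exists (Quad ((a %/ 2)%Z + 0) ((b %/ 2)%Z + 0)); rewrite h r0 s1.
- by exists (Quad ((a %/ 2)%Z + 0) ((b %/ 2)%Z + 0)); rewrite h r1 s0.
- by exists (Quad ((a %/ 2)%Z + 0) ((b %/ 2)%Z + 1)); rewrite h r1 s1.
Qed.

(** The unimodular lattice of minimum 2, whose isometry group is
    [{1, -1} x PSL(2, 7)].  It shares its genus with the lattice of the identity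
    matrix, which is why the genus alone does not decide the theorem. *)
Definition klein := Ternary 2 2 2 qomega (qconj qomega) (- qomega).

(** Exchanging [e1] and [e2] keeps [minor12] and exchanging [e2] and [e3] keeps
    [t11], so that [t11 + minor12] measures the progress of both moves. *)
Definition reducible t := exists t',
  [/\ unimodular3 t', represented (gram3 t) (gram3 t')
    & t11 t' + minor12 t' < t11 t + minor12 t].

Lemma reducible_rep t t' : represented (gram3 t) (gram3 t') ->
  t11 t' + minor12 t' <= t11 t + minor12 t -> reducible t' -> reducible t.
Proof.
move=> h le [u [uu hu lt]]; exists u; split=> //; last exact: lt_le_trans lt le.
exact: represented_trans h hu.
Qed.

Lemma reducible22 t : unimodular3 t -> t22 t < t11 t -> reducible t.
Proof.
move=> ut lt; exists (swap12 t); split; first exact: unimodular_swap12.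
  exact: swap12_rep.
by have [-> _] := swap12_invariants t; rewrite /=; lia.
Qed.

Lemma reducible13 t : unimodular3 t -> minor13 t < minor12 t -> reducible t.
Proof.
move=> ut lt; exists (swap23 t); split; first exact: unimodular_swap23.
  exact: swap23_rep.
by have [-> _ _ _] := swap23_invariants t; rewrite /=; lia.
Qed.

Lemma reducible33 t : unimodular3 t -> minor13 t <= minor12 t ->
  t33 t < t11 t -> reducible t.
Proof.
move=> ut le lt; apply: reducible_rep (swap23_rep t) _ _.
  by have [-> _ _ _] := swap23_invariants t; rewrite /=; lia.
by apply: reducible22; first exact: unimodular_swap23.
Qed.

(** The two inequalities are what Hermite reduction gives for [a = t11] and
    [D = minor12]; eliminating [D] leaves [a <= 7/3]. *)
Lemma hermite_bound (a D : int) : 0 < a -> 0 < D ->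
  3 * D ^+ 2 <= 7 * a -> 3 * a ^+ 2 <= 7 * D -> a = D /\ a <= 2.
Proof.
move=> a0 D0 h1 h2; have a2 : a <= 2.
  by case: (lerP D a) => ?; nia.
have D2 : D <= 2 by nia.
nia.
Qed.

(** A diagonal entry or a minor equal to 1 allows a further exchange, so all of
    [t22], [t33] and [minor13] are 2 and the off-diagonal data have norm 2.
    Solving [2 t23 = cominor + qconj t12 * t13] over the integers leaves the
    Klein matrix and its image under the exchange of [e2] and [e3]. *)
Lemma klein_normalized t : unimodular3 t -> t11 t = 2 -> minor12 t = 2 ->
  t12 t \in residues2 -> t13 t \in residues2 ->
  cominor t \in residues2 ->
  reducible t \/ represented (gram3 t) (gram3 klein).
Proof.
move=> ut a2 D2 ht12 ht13 hP.
have [_ _ det1] := ut; have PE := det3E t; rewrite det1 a2 D2 in PE.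
have N2 x : x \in residues2 -> [\/ x = 0, x = 1 | qnorm x = 2].
  by rewrite !inE => /or4P[] /eqP->; [exact: Or31 | exact: Or32 | exact: Or33..].
have r22 : t22 t = 1 -> reducible t by move=> h; apply: reducible22 ut _; lia.
have r13 : minor13 t = 1 -> reducible t by move=> h; apply: reducible13 ut _; lia.
have bN : 2 * t22 t = 2 + qnorm (t12 t) by move: D2; rewrite /minor12 a2; lia.
case: (N2 _ ht12) => bE; rewrite bE in bN.
- by left; apply: r22; move: bN; rewrite /qnorm /=; lia.
- by exfalso; move: bN; rewrite /qnorm /=; lia.
case: (N2 _ hP) => [P0|P1|PN].
- by left; apply: r13; move: PE; rewrite P0 /qnorm /=; lia.
- by exfalso; move: PE; rewrite P1 /qnorm /=; lia.
have D13 : minor13 t = 2 by lia.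
have dN : 2 * t33 t = 2 + qnorm (t13 t) by move: D13; rewrite /minor13 a2; lia.
case: (N2 _ ht13) => dE; rewrite dE in dN.
- left; apply: reducible33 ut _ _; rewrite ?D13 ?D2 //.
  by move: dN; rewrite /qnorm /=; lia.
- by exfalso; move: dN; rewrite /qnorm /=; lia.
right; have c2 : t22 t = 2 by lia.
have f2 : t33 t = 2 by lia.
have isK : t = klein \/ swap23 t = klein; last first.
  case: isK => <-; first exact: represented_refl.
  exact: swap23_rep.
have pure x : x \in residues2 -> qnorm x = 2 -> x = qomega \/ x = qconj qomega.
  by rewrite !inE => /or4P[] /eqP-> //; [left | right].
move: (pure _ ht12 bE) (pure _ ht13 dE) (pure _ hP PN).
clear - a2 c2 f2; case: t a2 c2 f2 => a c f b d [e1 e2] /= -> -> ->.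
rewrite /cominor /= => -[->|->] [->|->] [] [] /= h1 h2; try (exfalso; lia).
- by left; rewrite /klein; congr Ternary; apply: quadP; rewrite /=; lia.
- by right; rewrite /klein /swap23; congr Ternary; apply: quadP; rewrite /=; lia.
Qed.

Lemma t12_shear21 q t :
  t12 (shear21 (qconj (- q)) t) = t12 t - q * (t11 t)%:~R.
Proof. by rewrite /= qconjK mulNr. Qed.

Lemma t13_shear31 q t :
  t13 (shear31 (qconj (- q)) t) = t13 t - q * (t11 t)%:~R.
Proof. exact: t12_shear21. Qed.

(** [residues2] are representatives modulo 2 of minimal norm.  The shears are
    taken in this order because each leaves the entries normalized before it
    unchanged. *)
Lemma klein_case t : unimodular3 t -> t11 t = 2 -> minor12 t = 2 ->
  reducible t \/ represented (gram3 t) (gram3 klein).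
Proof.
move=> ut a2 D2.
have pull t' : represented (gram3 t) (gram3 t') -> t11 t' = 2 -> minor12 t' = 2 ->
    reducible t' \/ represented (gram3 t') (gram3 klein) ->
    reducible t \/ represented (gram3 t) (gram3 klein).
  move=> h a2' D2' [r|r]; last by right; apply: represented_trans h r.
  by left; apply: reducible_rep h _ r; rewrite a2 D2 a2' D2'.
have [q3 h3] := residue_mod2 (cominor t).
pose s3 := shear32 (qconj (- q3)) t.
have [D3 _ P3] := shear32_invariants (qconj (- q3)) t.
have [q2 h2] := residue_mod2 (t13 s3); pose s2 := shear31 (qconj (- q2)) s3.
have [D2' _ P2 _] := shear31_invariants (qconj (- q2)) s3.
have [q1 h1] := residue_mod2 (t12 s2); pose s1 := shear21 (qconj (- q1)) s2.
have [D1 _ P1 _] := shear21_invariants (qconj (- q1)) s2.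
have s1D : minor12 s1 = 2 by rewrite D1 D2' D3.
apply: (pull s1) => //.
  apply: represented_trans (shear32_rep _ _) _.
  exact: represented_trans (shear31_rep _ _) (shear21_rep _ _).
apply: klein_normalized => //.
- exact/unimodular_shear21/unimodular_shear31/unimodular_shear32.
- by rewrite t12_shear21 [t11 _]a2.
- by rewrite [t13 _]t13_shear31 [t11 _]a2.
- by rewrite /s1 P1 /s2 P2 /s3 P3 qconjK D2 mulNr.
Qed.

(** Hermite reduction.  If no exchange makes progress, rounding [cominor] modulo
    [minor12] gives [3 minor12 ^ 2 <= 7 t11], and rounding [t12] modulo [t11]
    gives [3 t11 ^ 2 <= 7 minor12]. *)
Theorem unimodular_reduction t : unimodular3 t ->
  represented (gram3 t) (1%:M : 'M_3) \/ represented (gram3 t) (gram3 klein).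
Proof.
have [n] := ubnP (absz (t11 t + minor12 t)); elim: n t => // n IHn t ltn ut.
have reduce t' : represented (gram3 t) (gram3 t') -> reducible t' ->
    t11 t' + minor12 t' = t11 t + minor12 t ->
    represented (gram3 t) (1%:M : 'M_3) \/ represented (gram3 t) (gram3 klein).
  move=> h [u [uu hu lt]] eq; have [a0 D0 _] := ut; have [a0' D0' _] := uu.
  have /IHn/(_ uu) : (absz (t11 u + minor12 u)%R < n)%N by lia.
  by case=> r; [left|right]; apply: represented_trans h (represented_trans hu r).
have [a0 D0 det1] := ut.
have [q hq] := rounding (cominor t) D0.
pose t1 := shear32 (qconj (- q)) t.
have ut1 : unimodular3 t1 by apply: unimodular_shear32.
have h1 : represented (gram3 t) (gram3 t1) by apply: shear32_rep.
have [Dt1 _ Pt1] := shear32_invariants (qconj (- q)) t; rewrite -/t1 in Dt1 Pt1.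
have {}hq : 7 * qnorm (cominor t1) <= 4 * minor12 t ^+ 2.
  by rewrite Pt1 qconjK mulNr [q * _]mulrC.
have [lt|ge1] := ltP (minor13 t1) (minor12 t1).
  by apply: (reduce t1 h1); [exact: reducible13 | rewrite Dt1].
have [_ _ det1'] := ut1; have := det3E t1; rewrite det1' Dt1 => E1.
have [r hr] := rounding (t12 t1) a0.
pose t2 := shear21 (qconj (- r)) t1.
have ut2 : unimodular3 t2 by apply: unimodular_shear21.
have h2 : represented (gram3 t) (gram3 t2).
  by apply: represented_trans h1 _; apply: shear21_rep.
have [Dt2 _ _ _] := shear21_invariants (qconj (- r)) t1; rewrite -/t2 Dt1 in Dt2.
have {}hr : 7 * qnorm (t12 t2) <= 4 * t11 t ^+ 2.
  by rewrite t12_shear21 [r * _]mulrC.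
have [lt|ge2] := ltP (t22 t2) (t11 t2).
  by apply: (reduce t2 h2); [exact: reducible22 | rewrite Dt2].
have D2E : t11 t * t22 t2 = minor12 t + qnorm (t12 t2) by rewrite -Dt2 /minor12 /=; lia.
have t1E : t11 t1 = t11 t by [].
have t2E : t11 t2 = t11 t by [].
rewrite t1E t2E Dt1 in E1 ge1 ge2.
have [aD a2] : t11 t = minor12 t /\ t11 t <= 2.
  apply: hermite_bound => //; nia.
have [a1|{}a2] : t11 t = 1 \/ t11 t = 2 by lia.
  by left; apply: cholesky_rep => //; rewrite -aD.
have D2 : minor12 t = 2 by rewrite -aD.
case: (klein_case ut a2 D2) => [red|]; last by right.
exact: (reduce t (represented_refl _) red).
Qed.

(** * Planes in the Klein lattice *)

(** An isometry of order 7 of the Klein lattice, in companion form. *)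
Definition klein_rot : 'M_3 := mx_of_rows 3 3
  [:: [:: 0; 0; 1]; [:: 1; 0; 0]; [:: qomega; 1; - qconj qomega]].

Lemma klein_rot_isometry :
  klein_rot *m gram3 klein *m adj klein_rot = gram3 klein.
Proof. mx_ring. Qed.

(** The rows span the sublattice of vectors whose first coordinate is divisible
    by [qomega]; it has index 2. *)
Definition hyperplane_mx : 'M_3 := mx_of_rows 3 3
  [:: [:: qomega; 0; 0]; [:: 0; 1; 0]; [:: 0; 0; 1]].

(** The sublattice is also contained in a unimodular neighbour of the Klein
    lattice at the prime [qomega]; as this neighbour contains vectors of norm 1,
    it is the standard lattice. *)
Lemma hyperplane_mx_rep :
  represented (hyperplane_mx *m gram3 klein *m adj hyperplane_mx) (1%:M : 'M_3).
Proof.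
exists (mx_of_rows 3 3
  [:: [:: 1; 1; qconj qomega]; [:: 0; -1; -1]; [:: 0; 0; qconj qomega]]).
rewrite mulmx1; mx_ring.
Qed.

(** The residue modulo the prime [qomega] of norm 2. *)
Definition odd_quad x : bool := ~~ (2 %| qre x)%Z.

Definition divw x := Quad ((qre x %/ 2)%Z + qim x) (- (qre x %/ 2)%Z).

Lemma divwK x : ~~ odd_quad x -> divw x * qomega = x.
Proof.
case: x => a b; rewrite /odd_quad negbK => /= h.
by apply: quadP; rewrite /=; lia.
Qed.

(** The action of [klein_rot] on rows modulo [qomega]. *)
Definition rot_bits (u : bool * bool * bool) := (u.1.2, u.2, u.1.1 (+) u.2).

(** Two vectors span at most a plane of the three-dimensional space over the
    field of two elements; [rot_bits] permutes its seven planes cyclically,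
    hence moves a plane through both vectors to the plane of first
    coordinate 0. *)
Lemma common_hyperplane u v :
  exists k, ~~ (iter k rot_bits u).1.1 /\ ~~ (iter k rot_bits v).1.1.
Proof.
move: u v => [[[] []] []] [[[] []] []];
  by [exists 0%N | exists 1%N | exists 2%N | exists 3%N | exists 4%N
     | exists 5%N | exists 6%N].
Qed.

Definition row_bits (X : 'M_(2, 3)) i :=
  (odd_quad (X i 0), odd_quad (X i 1), odd_quad (X i 2)).

Lemma row_bits_rot X i : row_bits (X *m klein_rot) i = rot_bits (row_bits X i).
Proof.
rewrite /row_bits /rot_bits /= !(mxE, big_ord_recl, big_ord0) /=.
have -> : lift ord0 ord0 = 1 :> 'I_3 by apply: val_inj.
have -> : lift ord0 (lift ord0 ord0) = 2 :> 'I_3 by apply: val_inj.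
have -> : ord0 = 0 :> 'I_3 by [].
case: (X i 0) (X i 1) (X i 2) => [a0 a1] [b0 b1] [c0 c1].
rewrite /odd_quad /=.
congr (_, _, _); lia.
Qed.

(** A binary sublattice reduces modulo [qomega] into a proper subspace, so that
    after an isometry it lies in the sublattice of [hyperplane_mx_rep]. *)
Lemma klein_section (X : 'M_(2, 3)) :
  represented (X *m gram3 klein *m adj X) (1%:M : 'M_3).
Proof.
have [k [u0 v0]] := common_hyperplane (row_bits X 0) (row_bits X 1).
pose Y := iter k (mulmx^~ klein_rot) X.
have YX : Y *m gram3 klein *m adj Y = X *m gram3 klein *m adj X.
  rewrite /Y; elim: (k) => //= m IHm; rewrite -{}IHm adjM -!mulmxA.
  by rewrite (mulmxA klein_rot) (mulmxA _ (adj klein_rot)) klein_rot_isometry.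
have bitsY i : row_bits Y i = iter k rot_bits (row_bits X i).
  by rewrite /Y; elim: (k) => //= m IHm; rewrite row_bits_rot IHm.
have Y0 i : ~~ odd_quad (Y i 0).
  have := congr1 (fun u => u.1.1) (bitsY i) => /= ->.
  by case: i => [[|[|//]]] h; [move: u0 | move: v0];
     congr (is_true (~~ (iter k rot_bits (row_bits X _)).1.1)); apply: val_inj.
rewrite -YX.
pose V : 'M_(2, 3) := \matrix_(i, j) if j == 0 then divw (Y i 0) else Y i j.
have -> : Y = V *m hyperplane_mx.
  apply/matrixP=> i j; rewrite !(mxE, big_ord_recl, big_ord0) /=.
  case: j => [[|[|[|//]]] h] /=.
  all: rewrite ?mulr0 ?mulr1 ?addr0 ?add0r.
  - by rewrite divwK //; congr (Y i _); apply: val_inj.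
  - by congr (Y i _); apply: val_inj.
  - by congr (Y i _); apply: val_inj.
have [Z ZE] := hyperplane_mx_rep.
exists (V *m Z); rewrite !adjM -!mulmxA; congr (V *m _).
by rewrite mulmxA mulmxA ZE !mulmxA.
Qed.

(** * Norms modulo a prime *)

Lemma invz_mod (a m : int) : coprimez a m -> exists j, (m %| a * j - 1)%Z.
Proof.
move=> /eqP co; have [u [v uv]] := Bezoutz a m; exists u.
by apply/dvdzP; exists (- v); rewrite -co -uv; ring.
Qed.

Lemma prime_coprimez (p : nat) (a : int) : prime p -> ~~ (p %| a)%Z -> coprimez a p.
Proof. by move=> pp; rewrite coprimezE dvdzE coprime_sym prime_coprime. Qed.

Lemma Euclid_dvdzM (p : nat) (a b : int) : prime p ->
  (p %| a * b)%Z = (p %| a)%Z || (p %| b)%Z.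
Proof. by move=> pp; rewrite !dvdzE abszM Euclid_dvdM. Qed.

(** Pigeonhole: the squares and the values [r - 7 t ^ 2] each fill more than
    half of the prime field. *)
Lemma sum_sq7_surjective (p : nat) (r : int) : prime p -> odd p -> p != 7 ->
  exists s t : int, (p %| s ^+ 2 + 7 * t ^+ 2 - r)%Z.
Proof.
move=> pp op p7; pose h := p./2; have pE : p = (h.*2).+1 by rewrite -[LHS]odd_double_half op.
have chp := pchar_Fp pp.
have sqI (i j : 'I_h.+1) : (i%:R : 'F_p) ^+ 2 = j%:R ^+ 2 -> i = j.
  move=> /eqP; rewrite eqf_sqr => /orP[]; last first.
    rewrite -subr_eq0 opprK -natrD -(dvdn_pcharf chp).
    have := ltn_ord i; have := ltn_ord j => ltj lti dv; apply: val_inj => /=.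
    have : (i + j = 0)%N by apply/eqP; rewrite -leqn0 leqNgt; apply/negP => ij0;
      have := dvdn_leq ij0 dv; lia.
    lia.
  move=> e; apply: val_inj => /=.
  have ltp (k : 'I_h.+1) : (k < p)%N by have := ltn_ord k; lia.
  have val (k : 'I_h.+1) : ((k%:R : 'F_p) = k :> nat)%N.
    by rewrite val_Fp_nat // modn_small.
  by rewrite -val (eqP e) val.
pose S := [set (i%:R : 'F_p) ^+ 2 | i : 'I_h.+1].
pose T := [set (r%:~R - 7 * i%:R ^+ 2 : 'F_p) | i : 'I_h.+1].
have nz7 : (7 : 'F_p) != 0.
  by rewrite -(dvdn_pcharf chp) dvdn_prime2.
have cS : #|S| = h.+1 by rewrite card_imset ?card_ord.
have cT : #|T| = h.+1.
  rewrite card_imset ?card_ord // => i j /addrI/oppr_inj/(mulfI nz7).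
  exact: sqI.
have /exists_inP[x /imsetP[i _ xi] /imsetP[j _ xj]] : [exists x in S, x \in T].
  apply: contraT => /exists_inPn dis.
  have : #|S :|: T| = (h.+1 + h.+1)%N.
    rewrite cardsU cS cT (_ : S :&: T = set0) ?cards0 ?subn0 //.
    by apply/setP=> x; rewrite !inE; apply/negP => /andP[/dis/negP].
  have : (#|S :|: T| <= #|'F_p|)%N by apply: max_card.
  by rewrite card_Fp //; lia.
exists i%:Z, j%:Z; rewrite (dvdz_pcharf chp).
rewrite rmorphB rmorphD (rmorphM _ 7) !rmorphXn /= -xi xj; apply/eqP; ring.
Qed.

(** Completing the square reduces the norm form to [s ^ 2 + 7 t ^ 2]; at 7 it
    degenerates and represents only squares. *)
Lemma qnorm_surjective_mod (p : nat) (r : int) : prime p -> p != 7 ->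
  exists x, (p %| qnorm x - r)%Z.
Proof.
move=> pp p7; have [op|ep] := boolP (odd p); last first.
  have -> : p = 2 by case: (even_prime pp) => // op; rewrite op in ep.
  have [e|o] := boolP (2 %| r)%Z.
    by exists 0; rewrite /qnorm /=; lia.
  by exists 1; rewrite /qnorm /=; lia.
have [s [t st]] := sum_sq7_surjective r pp op p7.
by exists (Quad (s - t) (2 * t)); congr (_ %| _ - _)%Z: st; rewrite /qnorm /=; ring.
Qed.

(** * Enlarging binary lattices *)

Record binary := Binary { b11 : int; b22 : int; b12 : quad }.

Definition gram2 t := mx_of_rows 2 2
  [:: [:: (b11 t)%:~R; b12 t]; [:: qconj (b12 t); (b22 t)%:~R]].
Definition det2 t := b11 t * b22 t - qnorm (b12 t).
Definition positive2 t := 0 < b11 t /\ 0 < det2 t.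

Definition swap2 t := Binary (b22 t) (b11 t) (qconj (b12 t)).
Definition shear2 q t := Binary (b11 t)
  (b22 t + qtrace (q * b12 t) + qnorm q * b11 t) (b12 t + qconj q * (b11 t)%:~R).

Lemma swap2_rep t : represented (gram2 t) (gram2 (swap2 t)).
Proof.
case: t => a c [b1 b2]; exists (mx_of_rows 2 2 [:: [:: 0; 1]; [:: 1; 0]]); mx_ring.
Qed.

Lemma shear2_rep q t : represented (gram2 t) (gram2 (shear2 q t)).
Proof.
case: t q => a c [b1 b2] [q1 q2].
exists (mx_of_rows 2 2 [:: [:: 1; 0]; [:: - Quad q1 q2; 1]]); mx_ring.
Qed.

Lemma det2_swap t : det2 (swap2 t) = det2 t.
Proof. by case: t => a c [b1 b2]; rewrite /det2; quad_simpl; ring. Qed.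

Lemma det2_shear q t : det2 (shear2 q t) = det2 t.
Proof. by case: t q => a c [b1 b2] [q1 q2]; rewrite /det2; quad_simpl; ring. Qed.

Lemma positive2_swap t : positive2 t -> positive2 (swap2 t).
Proof.
rewrite /positive2 det2_swap => -[a0 D0]; split=> //=.
by have := qnorm_ge0 (b12 t); move: D0; rewrite /det2; nia.
Qed.

Lemma positive2_shear q t : positive2 t -> positive2 (shear2 q t).
Proof. by rewrite /positive2 det2_shear. Qed.

(** The lattice is properly contained in another integral lattice of the same
    rank. *)
Definition refinable t := exists t',
  [/\ positive2 t', represented (gram2 t) (gram2 t') & det2 t' < det2 t].

Lemma refinable_rep t t' : represented (gram2 t) (gram2 t') ->
  det2 t' = det2 t -> refinable t' -> refinable t.
Proof.
move=> h e [u [pu hu lt]]; exists u; split; rewrite -?e //.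
exact: represented_trans h hu.
Qed.

Lemma refinable_swap2 t : refinable (swap2 t) -> refinable t.
Proof. exact: refinable_rep (swap2_rep t) (det2_swap t). Qed.

Lemma refinable_shear2 q t : refinable (shear2 q t) -> refinable t.
Proof. exact: refinable_rep (shear2_rep q t) (det2_shear q t). Qed.

(** Divides the second basis vector by [y]: the hypotheses say that this keeps
    the form integral. *)
Lemma refinable_div y t b : positive2 t -> 1 < qnorm y -> (qnorm y %| b22 t)%Z ->
  b12 t = b * qconj y -> refinable t.
Proof.
case: t => a c b' [/= a0]; rewrite {1}/det2 /= => D0 y1 /dvdzP[c' cE] bE.
have nE : qnorm (b * qconj y) = qnorm b * qnorm y.
  by rewrite qnormM; congr (_ * _); rewrite /qnorm /=; ring.
exists (Binary a c' b); rewrite /positive2 /det2 /=.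
have D'0 : 0 < a * c' - qnorm b.
  by move: D0; rewrite bE cE nE; nia.
split=> //; last by rewrite bE cE nE; nia.
rewrite cE bE {bE nE cE D0 D'0}; case: b y y1 => [u v] [y1 y2] _.
exists (mx_of_rows 2 2 [:: [:: 1; 0]; [:: 0; Quad y1 y2]]); mx_ring.
Qed.

Definition qsqrtm7 : quad := Quad (-1) 2.

(** 7 is ramified: the prime above it is generated by [qsqrtm7], which is
    associate to its conjugate. *)
Lemma dvd_norm7 x : (7 %| qnorm x)%Z -> exists b, x = b * qconj qsqrtm7.
Proof.
case: x => m n /dvdzP[k]; rewrite /qnorm /= => nE.
have /dvdzP[l lE] : (7 %| 2 * m + n)%Z.
  have : (7 %| (2 * m + n) ^+ 2)%Z.
    by apply/dvdzP; exists (4 * k - n ^+ 2); lia.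
  by rewrite expr2 (@Euclid_dvdzM 7) // orbb.
exists (Quad m 0 + Quad l 0 * (Quad 0 1 * qsqrtm7)).
apply: quadP; rewrite /=; lia.
Qed.

(** Modulo [qsqrtm7] conjugation is trivial, so the form becomes a singular
    symmetric form over the field of seven elements.  A vector of its radical
    has norm divisible by 7 and can be divided by [qsqrtm7]. *)
Lemma refinable7 t : positive2 t -> (7 %| det2 t)%Z -> refinable t.
Proof.
move=> pt D7.
(* applies once the second basis vector spans the radical *)
have divide_second t' : positive2 t' -> (7 %| b22 t')%Z ->
    (7 %| qnorm (b12 t'))%Z -> refinable t'.
  move=> pt' c7 /dvd_norm7[b bE]; exact: (@refinable_div qsqrtm7 _ b).
have [a7|a7] := boolP (7 %| b11 t)%Z.
  apply/refinable_swap2/divide_second; rewrite ?det2_swap //; first exact: positive2_swap.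
  have -> : qnorm (b12 (swap2 t)) = b11 t * b22 t - det2 t.
    by rewrite /det2; quad_simpl; ring.
  by rewrite rpredB // dvdz_mulr.
have [j jE] := invz_mod (@prime_coprimez 7 _ isT a7).
pose k := - j * 4 * qtrace (b12 t).
have n7 : (7 %| qnorm (b12 (shear2 k%:~R t)))%Z.
  have : (7 %| 4 * qnorm (b12 (shear2 k%:~R t)))%Z.
    have -> : 4 * qnorm (b12 (shear2 k%:~R t)) =
       (qtrace (b12 t) + 2 * k * b11 t) ^+ 2 + 7 * qim (b12 t) ^+ 2.
      by case: (t) => a c [b1 b2]; quad_simpl; ring.
    rewrite rpredD ?dvdz_mulr // /k.
    have -> : qtrace (b12 t) + 2 * (- j * 4 * qtrace (b12 t)) * b11 t =
      - (8 * qtrace (b12 t)) * (b11 t * j - 1) - 7 * qtrace (b12 t) by ring.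
    by apply: rpredB; [apply: dvdz_mull | apply: dvdz_mulr].
  by rewrite (@Euclid_dvdzM 7).
apply: (@refinable_shear2 k%:~R); apply: divide_second; rewrite ?det2_shear //.
  exact: positive2_shear.
have : (7 %| b11 t * b22 (shear2 k%:~R t))%Z.
  have -> : b11 t * b22 (shear2 k%:~R t) = det2 (shear2 k%:~R t) + qnorm (b12 (shear2 k%:~R t)).
    by rewrite /det2 /=; ring.
  by rewrite rpredD // det2_shear.
by rewrite (@Euclid_dvdzM 7) // (negPf a7).
Qed.

Definition dvd_gram2 (p : nat) t :=
  [&& p %| b11 t, p %| b22 t, p %| qre (b12 t) & p %| qim (b12 t)]%Z.

(** The trace form has Gram determinant -7: when it vanishes modulo [p] on both
    [x] and [qomega * x], then 7 times each coordinate of [x] is 0. *)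
Lemma unit_trace (p : nat) x : prime p -> p != 7 ->
  ~~ ((p %| qre x)%Z && (p %| qim x)%Z) -> exists q, ~~ (p %| qtrace (q * x))%Z.
Proof.
move=> pp p7 nx.
have [t1|t1] := boolP (p %| qtrace x)%Z; last by exists 1; rewrite mul1r.
have [t2|t2] := boolP (p %| qtrace (qomega * x))%Z; last by exists qomega.
case/negP: nx; move: t1 t2; case: x => m n; rewrite /qtrace /= => t1 t2.
have co7 : (p %| 7)%Z = false.
  by apply: negbTE; rewrite dvdzE dvdn_prime2.
have mp : (p %| m)%Z.
  have : (p %| 7 * m)%Z.
    have -> : 7 * m = 3 * (2 * m + n)
        + (2 * (0 * m - 2 * 1 * n) + (0 * n + 1 * m + 1 * n)) by ring.
    by rewrite rpredD // dvdz_mull.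
  by rewrite Euclid_dvdzM // co7.
rewrite mp /=; have -> : n = (2 * m + n) - 2 * m by ring.
by rewrite rpredB // dvdz_mull.
Qed.

(** A Hermitian form that is nonzero modulo [p] takes a nonzero value there. *)
Lemma unit_diagonal (p : nat) t : prime p -> p != 7 -> positive2 t ->
  ~~ dvd_gram2 p t -> exists t', [/\ positive2 t', represented (gram2 t) (gram2 t'),
    det2 t' = det2 t & ~~ (p %| b11 t')%Z].
Proof.
move=> pp p7 pt ndv.
have [a|a] := boolP (p %| b11 t)%Z; last first.
  by exists t; split=> //; apply: represented_refl.
have c_case t' : positive2 t' -> represented (gram2 t) (gram2 t') -> det2 t' = det2 t ->
    ~~ (p %| b22 t')%Z -> exists t', [/\ positive2 t', represented (gram2 t) (gram2 t'),
    det2 t' = det2 t & ~~ (p %| b11 t')%Z].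
  move=> pt' h e nc; exists (swap2 t'); split=> //; first exact: positive2_swap.
    exact: represented_trans h (swap2_rep _).
  by rewrite det2_swap.
have [c|c] := boolP (p %| b22 t)%Z; last first.
  by apply: (c_case t) => //; apply: represented_refl.
have [q nq] : exists q, ~~ (p %| qtrace (q * b12 t))%Z.
  by apply: unit_trace => //; move: ndv; rewrite /dvd_gram2 a c.
apply: (c_case (shear2 q t)); [exact: positive2_shear | exact: shear2_rep |
  exact: det2_shear | ].
apply: contra nq => /= h.
have -> : qtrace (q * b12 t) = b22 t + qtrace (q * b12 t) + qnorm q * b11 t
   - b22 t - qnorm q * b11 t by ring.
by rewrite !rpredB // dvdz_mull.
Qed.

(** Some vector that is nonzero modulo [p] has norm divisible by [p ^ 2] and
    inner products divisible by [p], so it can be divided by [p].  If the form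
    is [p] times another one, this is an isotropic vector modulo [p] of the
    latter; otherwise it is the projection of one basis vector to the
    orthogonal complement of one whose norm is a unit modulo [p]. *)
Lemma refinable_sq (p : nat) t : prime p -> p != 7 -> positive2 t ->
  (p%:Z ^+ 2 %| det2 t)%Z -> refinable t.
Proof.
move=> pp p7 pt Dp.
have p1 : 1 < p%:Z by have := prime_gt1 pp; lia.
have n1 : 1 < qnorm p%:Z%:~R by rewrite quad_intr /qnorm /=; nia.
have nE : qnorm p%:Z%:~R = p%:Z ^+ 2 by rewrite quad_intr /qnorm /=; ring.
have divide_second t' : positive2 t' -> (p%:Z ^+ 2 %| b22 t')%Z ->
    (p %| qre (b12 t'))%Z -> (p %| qim (b12 t'))%Z -> refinable t'.
  move=> pt' c /dvdzP[u uE] /dvdzP[v vE].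
  apply: (@refinable_div p%:Z%:~R _ (Quad u v) pt' n1); rewrite ?nE //.
  by apply: quadP; rewrite ?uE ?vE [X in _ * qconj X]quad_intr /=; ring.
have [dv|ndv] := boolP (dvd_gram2 p t).
(* The form is p times an integral form, which has an isotropic vector modulo
   p, being a form in four variables over the prime field. *)
- case/and4P: dv => /dvdzP[a aE] /dvdzP[c cE] ub vb.
  have [/dvdzP[u uE] /dvdzP[v vE]] := (ub, vb).
  have [pa|pa] := boolP (p %| a)%Z.
    apply/refinable_swap2/divide_second; first exact: positive2_swap.
    + by rewrite /= aE expr2 dvdz_mul.
    + by rewrite /= rpredD.
    + by rewrite /= rpredN.
  have [j jE] := invz_mod (prime_coprimez pp pa).
  have [x xE] := qnorm_surjective_mod (- (a * c - qnorm (Quad u v))) pp p7.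
  (* completing the square: a times the norm of e2 + q e1, divided by p, is
     qnorm x + (a c - qnorm (Quad u v)) modulo p *)
  pose q := j%:~R * (x - qconj (Quad u v)).
  have bE : b12 t = Quad (u * p) (v * p) by apply: quadP.
  have sE r : b12 (shear2 r t)
      = Quad ((u + qre (qconj r) * a) * p) ((v + qim (qconj r) * a) * p).
    by case: r => r1 r2; rewrite /= aE bE quad_intr; apply: quadP; rewrite /=; ring.
  apply: (@refinable_shear2 q); apply: divide_second; first exact: positive2_shear.
  + have -> : b22 (shear2 q t) = (c + qtrace (q * Quad u v) + qnorm q * a) * p.
      rewrite /= cE aE bE.
      by case: (q) => q1 q2; quad_simpl; ring.
    rewrite expr2 dvdz_mul //.
    have : (p %| a * (c + qtrace (q * Quad u v) + qnorm q * a))%Z; last first.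
      by rewrite Euclid_dvdzM // (negPf pa).
    have -> : a * (c + qtrace (q * Quad u v) + qnorm q * a) =
        (qnorm x + (a * c - qnorm (Quad u v)))
        + (a * j - 1) * (qtrace ((x - qconj (Quad u v)) * qconj x)
          + (a * j - 1) * qnorm (x - qconj (Quad u v))).
      rewrite /q; case: (x) => x1 x2; quad_simpl; ring.
    by rewrite rpredD ?dvdz_mulr // -[X in qnorm x + X]opprK.
  + by rewrite sE /= dvdz_mull.
  + by rewrite sE /= dvdz_mull.
- have [t' [pt' h e a]] := unit_diagonal pp p7 pt ndv.
  apply: (refinable_rep h e).
  have cop2 : coprimez (b11 t') (p%:Z ^+ 2).
    by rewrite coprimez_pexpr //; apply: prime_coprimez.
  have [j jE] := invz_mod cop2.
  pose q := - (j%:~R * qconj (b12 t')).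
  have mE : (p%:Z ^+ 2 %| 1 - b11 t' * j)%Z by rewrite -opprB rpredN.
  set m := 1 - b11 t' * j in mE.
  have bE : b12 (shear2 q t') = Quad (m * qre (b12 t')) (m * qim (b12 t')).
    by rewrite /q /m; case: (t') => a' c' [b1 b2]; quad_ring.
  have pm k : (p %| m * k)%Z.
    by rewrite dvdz_mulr //; apply: dvdz_trans mE; rewrite expr2 dvdz_mulr.
  have pts := positive2_shear q pt'.
  apply: (@refinable_shear2 q); apply: divide_second => //; try by rewrite bE; apply: pm.
  rewrite -(@Gauss_dvdzr _ (b11 t')) 1?coprimez_sym //.
  have -> : b11 t' * b22 (shear2 q t') = det2 t + m * (m * qnorm (b12 t')).
    rewrite -e -(det2_shear q) /det2 bE; move: (b22 _) => c'.
    by rewrite /qnorm /=; ring.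
  by rewrite rpredD // dvdz_mulr.
Qed.

(** * Binary lattices inside unimodular ternary lattices *)

(** The determinant of an extension by a vector with inner products [x] and [y]
    is governed by the adjoint form, see [det3_extend]: an extension of
    determinant 1 exists as soon as this form takes the value -1 modulo
    [det2 t]. *)
Definition adjoint_form t x y : int :=
  b11 t * qnorm y + b22 t * qnorm x - qtrace (b12 t * y * qconj x).

Definition extend t x y z := Ternary (b11 t) (b22 t) z (b12 t) x y.

Lemma det3_extend t x y z :
  det3 (extend t x y z) = det2 t * z - adjoint_form t x y.
Proof.
case: t x y => a c [b1 b2] [x1 x2] [y1 y2].
by rewrite /det3 /det2 /adjoint_form; quad_simpl; ring.
Qed.

Lemma extend_rep t x y z : represented (gram2 t) (gram3 (extend t x y z)).
Proof.
case: t x y => a c [b1 b2] [x1 x2] [y1 y2].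
exists (mx_of_rows 2 3 [:: [:: 1; 0; 0]; [:: 0; 1; 0]]); mx_ring.
Qed.

Lemma adjoint_form_scale t s x y :
  adjoint_form t (s * x) (s * y) = qnorm s * adjoint_form t x y.
Proof.
case: t s x y => a c [b1 b2] [s1 s2] [x1 x2] [y1 y2].
by rewrite /adjoint_form; quad_simpl; ring.
Qed.

Lemma adjoint_form_mod t (m : int) x y x' y' :
  (m %| adjoint_form t (x + m%:~R * x') (y + m%:~R * y') - adjoint_form t x y)%Z.
Proof.
apply/dvdzP; exists (b11 t * (qtrace (y * qconj y') + m * qnorm y')
  + b22 t * (qtrace (x * qconj x') + m * qnorm x')
  - qtrace (b12 t * (y * qconj x' + y' * qconj x + m%:~R * y' * qconj x'))).
case: t x y x' y' => a c [b1 b2] [x1 x2] [y1 y2] [u1 u2] [v1 v2].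
by rewrite /adjoint_form; quad_simpl; ring.
Qed.

(** Scaling the arguments by [s] multiplies a nonzero value by the norm of [s],
    which can be any residue. *)
Lemma adjoint_form_prime (p : nat) t : prime p -> p != 7 -> ~~ dvd_gram2 p t ->
  exists x y, (p %| adjoint_form t x y + 1)%Z.
Proof.
move=> pp p7 ndv.
have [x [y nxy]] : exists x y, ~~ (p %| adjoint_form t x y)%Z.
  have e0 x y : adjoint_form t x y = b11 t * qnorm y + b22 t * qnorm x
     - qtrace (b12 t * y * qconj x) by [].
  have [a|a] := boolP (p %| b11 t)%Z; last first.
    exists 0, 1; suff -> : adjoint_form t 0 1 = b11 t by [].
    by rewrite e0; case: (t) => a1 c1 [b1 b2]; quad_simpl; ring.
  have [c|c] := boolP (p %| b22 t)%Z; last first.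
    exists 1, 0; suff -> : adjoint_form t 1 0 = b22 t by [].
    by rewrite e0; case: (t) => a1 c1 [b1 b2]; quad_simpl; ring.
  have [q nq] : exists q, ~~ (p %| qtrace (q * b12 t))%Z.
    by apply: unit_trace => //; move: ndv; rewrite /dvd_gram2 a c.
  exists 1, q; apply: contra nq; rewrite e0 rmorph1 mulr1 [b12 t * q]mulrC => h.
  have -> : qtrace (q * b12 t) = b11 t * qnorm q + b22 t * qnorm 1
     - (b11 t * qnorm q + b22 t * qnorm 1 - qtrace (q * b12 t)) by ring.
  by rewrite rpredB // rpredD // dvdz_mulr.
have [j jE] := invz_mod (prime_coprimez pp nxy).
have [s sE] := qnorm_surjective_mod (- j) pp p7.
exists (s * x), (s * y); rewrite adjoint_form_scale.
have -> : qnorm s * adjoint_form t x y + 1 =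
   (qnorm s - - j) * adjoint_form t x y - (adjoint_form t x y * j - 1) by ring.
by rewrite rpredB // dvdz_mulr.
Qed.

Lemma adjoint_form_squarefree (n : nat) t : (0 < n)%N ->
  (forall p, prime p -> (p %| n)%N ->
     ~~ (p ^ 2 %| n)%N /\ exists x y, (p %| adjoint_form t x y + 1)%Z) ->
  exists x y, (n %| adjoint_form t x y + 1)%Z.
Proof.
have [m] := ubnP n; elim: m n => // m IHm n /ltnSE len n0 hn.
have [n1|n1] := leqP n 1.
  have -> : n = 1%N by lia.
  by exists 0, 0; rewrite dvd1z.
pose p := pdiv n; have pp : prime p by apply: pdiv_prime.
have /dvdnP[k nE] := pdiv_dvd n; rewrite -/p in nE.
have p_n : (p %| n)%N by rewrite nE dvdn_mull.
have [sqf [x1 [y1 h1]]] := hn p pp p_n.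
have k0 : (0 < k)%N by move: n0; rewrite nE muln_gt0 => /andP[].
have p1 := prime_gt1 pp.
have ltk : (k < m)%N by apply: leq_trans len; rewrite nE ltn_Pmulr.
have [q qp qk|x2 [y2 h2]] := IHm k ltk k0.
  have [|nsq hq] := hn q qp; first by rewrite nE dvdn_mulr.
  split=> //; apply: contra nsq => h; by rewrite nE dvdn_mulr.
have co : coprime p k.
  rewrite prime_coprime //; apply: contra sqf => pk.
  by rewrite nE expnS expn1 dvdn_mul.
have /eqP coz : coprimez p k by rewrite coprimezE.
have [u [v uv]] := Bezoutz p k; rewrite coz in uv.
exists (x1 + p%:~R * (u%:~R * (x2 - x1))), (y1 + p%:~R * (u%:~R * (y2 - y1))).
have crt a b : a + p%:Z%:~R * (u%:~R * (b - a))
    = b + k%:Z%:~R * (v%:~R * (a - b)) :> quad.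
  have uvq : u%:~R * p%:Z%:~R + v%:~R * k%:Z%:~R = 1 :> quad.
    by rewrite -!intrM -intrD uv.
  apply: subr0_eq; transitivity ((a - b) * (1 - (u%:~R * p%:Z%:~R + v%:~R * k%:Z%:~R))).
    by ring.
  by rewrite uvq subrr mulr0.
rewrite nE PoszM [k%:Z * _]mulrC Gauss_dvdz ?coprimezE //; apply/andP; split.
  rewrite -(subrK (adjoint_form t x1 y1) (adjoint_form _ _ _)) -addrA rpredD //.
  exact: adjoint_form_mod.
rewrite !crt -(subrK (adjoint_form t x2 y2) (adjoint_form _ _ _)) -addrA rpredD //.
exact: adjoint_form_mod.
Qed.

(** Enlarging the lattice as long as possible leaves a squarefree determinant
    prime to 7.  Then the Gram matrix vanishes modulo none of the primes
    dividing the determinant, as otherwise their squares would divide it. *)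
Theorem positive2_unimodular t : positive2 t ->
  exists u, unimodular3 u /\ represented (gram2 t) (gram3 u).
Proof.
have [m] := ubnP (absz (det2 t)); elim: m t => // m IHm t /ltnSE lt_m pt.
have from_refinable : refinable t ->
    exists u, unimodular3 u /\ represented (gram2 t) (gram3 u).
  case=> t' [pt' h lt]; have [] := IHm t' _ pt'.
    by case: (pt) (pt') => _ D0 [_ D0']; lia.
  by move=> u [uu hu]; exists u; split=> //; apply: represented_trans h hu.
have [D7|D7] := boolP (7 %| det2 t)%Z.
  exact/from_refinable/refinable7.
have [a0 D0] := pt.
have D_nat : (absz (det2 t))%:Z = det2 t by lia.
set D := absz (det2 t) in D_nat lt_m.
have ne7 p : prime p -> (p %| D)%N -> p != 7.
  by move=> _ pD; apply: contraNneq D7 => p7; rewrite dvdzE p7 in pD *.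
have [/hasP[p]|/hasPn squarefree] := boolP (has (fun p => p ^ 2 %| D)%N (primes D)).
  rewrite mem_primes => /and3P[pp _ pD] sq.
  apply/from_refinable/(refinable_sq pp (ne7 p pp pD) pt).
  by rewrite dvdzE abszX.
have [||x [y /dvdzP[z zE]]] := @adjoint_form_squarefree D t.
- by lia.
- move=> p pp pD; have nsq : ~~ (p ^ 2 %| D)%N.
    by apply: squarefree; rewrite mem_primes pp pD; lia.
  split=> //; apply: adjoint_form_prime => //; first exact: ne7.
  apply: contra nsq => /and4P[a c /dvdzP[u uE] /dvdzP[v vE]].
  have : (p%:Z ^+ 2 %| det2 t)%Z; last by rewrite dvdzE abszX.
  rewrite /det2 expr2 rpredB //; first exact: dvdz_mul.
  by apply/dvdzP; exists (qnorm (Quad u v)); rewrite /qnorm uE vE /=; ring.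
exists (extend t x y z); split; last exact: extend_rep.
by split=> //; rewrite det3_extend -D_nat mulrC -zE; ring.
Qed.

(** Every binary lattice sits in a unimodular ternary lattice; if the latter is
    the Klein lattice, an index 2 sublattice takes over. *)
Theorem positive2_represented t : positive2 t ->
  represented (gram2 t) (1%:M : 'M_3).
Proof.
case/positive2_unimodular=> u [uu [X ->]].
have [[Y ->]|[Y ->]] := unimodular_reduction uu.
  by exists (X *m Y); rewrite adjM !mulmxA.
have := klein_section (X *m Y).
by rewrite adjM !mulmxA.
Qed.

(** * Embedding the ring of integers in the field *)

Lemma omega_in_Qsqrtm7 : omega \in Qsqrtm7.
Proof.
apply/Qsqrtm7P; exists (1 / 2), (1 / 2).
by rewrite [ratr _]fmorph_div rmorph1 rmorph_nat /omega; field.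
Qed.

Definition omegaE : E := InE omega_in_Qsqrtm7.

Lemma E_val_inj : injective E_val. Proof. exact: val_inj. Qed.

Definition emb (x : quad) : E := (qre x)%:~R + (qim x)%:~R * omegaE.

Lemma E_val_emb x : E_val (emb x) = (qre x)%:~R + (qim x)%:~R * omega.
Proof. by rewrite /emb rmorphD rmorphM !rmorph_int. Qed.

Lemma emb_is_zmod_morphism : zmod_morphism emb.
Proof. by move=> x y; rewrite /emb !rmorphB /=; ring. Qed.

Lemma emb_is_monoid_morphism : monoid_morphism emb.
Proof.
have om2 : omega ^+ 2 = omega - 2.
  have -> : omega ^+ 2 = omega - 2 + (sqrtm7 ^+ 2 + 7) / 4.
    by rewrite /omega; field.
  by rewrite sqr_sqrtm7 addNr mul0r addr0.
split=> [|x y]; apply: E_val_inj; last rewrite [RHS]rmorphM.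
  by rewrite E_val_emb /= mul0r addr0.
rewrite !E_val_emb /=.
rewrite !(rmorphD, rmorphB) /= !(intrM) /=.
transitivity ((qre x)%:~R * (qre y)%:~R + ((qre x)%:~R * (qim y)%:~R
  + (qim x)%:~R * (qre y)%:~R) * omega + (qim x)%:~R * (qim y)%:~R * omega ^+ 2).
  by rewrite om2; ring.
by ring.
Qed.

HB.instance Definition _ :=
  GRing.isZmodMorphism.Build quad E emb emb_is_zmod_morphism.
HB.instance Definition _ :=
  GRing.isMonoidMorphism.Build quad E emb emb_is_monoid_morphism.

Lemma E_val_conj z : E_val (conjE z) = (E_val z)^*. Proof. by []. Qed.

Lemma emb_conj x : emb (qconj x) = conjE (emb x).
Proof.
have omc : omega^* = 1 - omega.
  rewrite /omega rmorphM rmorphD /= rmorph1 conj_sqrtm7 fmorphV rmorph_nat.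
  by field.
apply: E_val_inj; rewrite E_val_conj !E_val_emb [RHS]rmorphD.
rewrite [X in _ = _ + X]rmorphM /= omc !rmorph_int.
by rewrite rmorphD rmorphN /=; ring.
Qed.

Lemma emb_OE x : emb x \in OE.
Proof. by apply/OEP; exists (qre x), (qim x); rewrite E_val_emb. Qed.

Lemma OE_emb z : z \in OE -> exists x, z = emb x.
Proof.
by case/OEP=> a [b ab]; exists (Quad a b); apply: E_val_inj; rewrite E_val_emb.
Qed.

Lemma E_val_int (n : int) : E_val (emb n%:~R) = n%:~R.
Proof. by rewrite !rmorph_int. Qed.

Lemma E_valM : {morph E_val : x y / x * y}. Proof. by []. Qed.
Lemma embM : {morph emb : x y / x * y}. Proof. exact: rmorphM. Qed.
Lemma embD : {morph emb : x y / x + y}. Proof. exact: rmorphD. Qed.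
Lemma embB : {morph emb : x y / x - y}. Proof. exact: rmorphB. Qed.

Lemma emb_eq0 x : (emb x == 0) = (x == 0).
Proof.
apply/eqP/eqP => [e|->]; last exact: rmorph0.
apply/eqP; rewrite -qnorm_eq0 -(@intr_eq0 algC) -E_val_int -mul_qconj embM e.
by rewrite mul0r.
Qed.

Lemma emb_inj : injective emb.
Proof.
move=> x y e; apply: subr0_eq; apply/eqP; rewrite -emb_eq0 embB.
by rewrite subr_eq0; apply/eqP.
Qed.

Lemma denominator (z : E) : exists d x, d != 0 /\ emb d * z = emb x.
Proof.
case: z => z0 zQ; have /Qsqrtm7P[r [s zE]] := zQ.
exists (denq r * denq s)%:~R.
exists (Quad (numq r * denq s - numq s * denq r) (2 * numq s * denq r)); split.
  by rewrite quad_intr; apply/eqP => -[] /eqP; rewrite mulf_eq0 !denq_eq0.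
apply: E_val_inj; rewrite E_valM E_val_int E_val_emb /= zE.
rewrite /omega.
have rE : ratr r = (numq r)%:~R / (denq r)%:~R :> algC by [].
have sE : ratr s = (numq s)%:~R / (denq s)%:~R :> algC by [].
have dr : (denq r)%:~R != 0 :> algC by rewrite intr_eq0 denq_eq0.
have ds : (denq s)%:~R != 0 :> algC by rewrite intr_eq0 denq_eq0.
rewrite rE sE rmorphB !intrM /=.
by field; rewrite dr ds.
Qed.

Lemma common_denominator n (c : 'I_n -> E) :
  exists d (a : 'I_n -> quad), d != 0 /\ forall i, emb d * c i = emb (a i).
Proof.
have [d dP] := fin_all_exists (fun i => denominator (c i)).
have [x xP] := fin_all_exists dP.
exists (\prod_i d i), (fun i => (\prod_(j | j != i) d j) * x i); split.
  rewrite -emb_eq0 rmorph_prod prodf_seq_neq0; apply/allP => i _ /=.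
  by rewrite emb_eq0; case: (xP i).
move=> i; rewrite (bigD1 i) //= [d i * _]mulrC !embM -mulrA.
by case: (xP i) => _ ->.
Qed.

(** * Bases of finitely generated modules *)

Lemma euclidean_division (x y : quad) : y != 0 -> exists q, qnorm (x - q * y) < qnorm y.
Proof.
move=> y0; have n0 : 0 < qnorm y by rewrite lt_def qnorm_eq0 y0 qnorm_ge0.
have [q qE] := rounding (x * qconj y) n0; exists q.
have nE : qnorm (x * qconj y - (qnorm y)%:~R * q) = qnorm (x - q * y) * qnorm y.
  rewrite -mul_qconj (_ : _ - _ = (x - q * y) * qconj y); last by ring.
  by rewrite qnormM; congr (_ * _); rewrite /qnorm /=; ring.
have {qE} := qE; rewrite nE; move: (qnorm (x - _)) (qnorm y) n0 => a b b0 h.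
by rewrite -(ltr_pM2r b0); have := mulr_gt0 b0 b0; lia.
Qed.

Lemma Ospan_lin (V : lmodType E) (s : seq V) a x y :
  Ospan s x -> Ospan s y -> Ospan s (emb a *: x + y).
Proof.
move=> [c cO ->] [d dO ->]; exists (fun i => emb a * c i + d i) => [i|].
  by rewrite rpredD ?rpredM ?emb_OE.
by rewrite scaler_sumr -big_split; apply: eq_bigr => i _; rewrite /= scalerA scalerDl.
Qed.

Lemma Ospan0 (V : lmodType E) (s : seq V) : Ospan s 0.
Proof.
exists (fun=> 0) => [i|]; first exact: rpred0.
by rewrite big1 // => i _; rewrite scale0r.
Qed.

Lemma Ospan_mem (V : lmodType E) (s : seq V) x : x \in s -> Ospan s x.
Proof.
move=> xs; have lt : (index x s < size s)%N by rewrite index_mem.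
exists (fun i => (i == Ordinal lt)%:R) => [i|]; first exact: rpred_nat.
rewrite (bigD1 (Ordinal lt)) //= eqxx scale1r nth_index // big1 ?addr0 // => i.
by move/negPf ->; rewrite scale0r.
Qed.

Lemma Ospan_trans (V : lmodType E) (s s' : seq V) y :
  {in s, forall x, Ospan s' x} -> Ospan s y -> Ospan s' y.
Proof.
move=> sub [c cO ->]; elim/big_rec: _ => [|i z _ hz]; first exact: Ospan0.
have [a ->] := OE_emb (cO i); apply: Ospan_lin hz; apply: sub.
exact: mem_nth.
Qed.

(** Euclidean algorithm on a linear relation, with the sum of the norms of its
    coefficients as measure: replacing [s_i] by [s_i + q s_j] replaces [c_j] by
    [c_j - q c_i].  When a single coefficient is left, its generator is 0. *)
Lemma shorten_generators (V : lmodType E) (s : seq V) (c : nat -> quad) :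
  \sum_(i < size s) emb (c i) *: s`_i = 0 ->
  (exists i : 'I_(size s), c i != 0) ->
  exists2 s', (size s' < size s)%N & forall x, Ospan s' x <-> Ospan s x.
Proof.
have [m] := ubnP (\sum_(i < size s) absz (qnorm (c i)))%N.
elim: m s c => // m IHm s c /ltnSE lt_m rel [i0 ci0].
case: (@arg_minnP _ i0 (fun i => c i != 0) (fun i => absz (qnorm (c i))) ci0) => i ci imin.
have [/existsP[j /andP[ji cj]]|alone] :=
    boolP [exists j : 'I_(size s), (j != i) && (c j != 0)]; last first.
  have si : s`_i = 0.
    move: rel; rewrite (bigD1 i) //= big1 ?addr0 => [/eqP|j ji].
      by rewrite scaler_eq0 emb_eq0 (negPf ci) => /eqP.
    have := existsPn alone j; rewrite ji /= negbK => /eqP ->.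
    by rewrite rmorph0 scale0r.
  have s0 : 0 \in s by rewrite -si mem_nth.
  exists (rem 0 s); first by rewrite size_rem // prednK // (leq_trans _ (ltn_ord i)).
  move=> x; split; apply: Ospan_trans => y ys.
    by apply: Ospan_mem; apply: mem_rem ys.
  have := perm_mem (perm_to_rem s0) y; rewrite ys inE => /esym/orP[/eqP->|].
    exact: Ospan0.
  exact: Ospan_mem.
have [q qlt] := euclidean_division (c j) ci.
pose s1 := set_nth 0 s i (s`_i + emb q *: s`_j).
pose c1 (k : nat) := if k == j :> nat then c j - q * c i else c k.
have size1 : size s1 = size s by rewrite size_set_nth (maxn_idPr _).
have s1E k : s1`_k = if k == i then s`_i + emb q *: s`_j else s`_k.
  by rewrite nth_set_nth.
have ij : i != j by rewrite eq_sym.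
have span1 x : Ospan s1 x <-> Ospan s x.
  split; apply: Ospan_trans => y /(nthP 0)[k]; rewrite ?size1 => lt <-.
    rewrite s1E; case: ifP => _; last by apply/Ospan_mem/mem_nth.
    by rewrite addrC; apply: Ospan_lin; apply/Ospan_mem/mem_nth.
  have mem1 l : (l < size s)%N -> Ospan s1 s1`_l.
    by move=> ltl; apply/Ospan_mem/mem_nth; rewrite size1.
  have [->|ki] := eqVneq k i; last by have := mem1 k lt; rewrite s1E (negPf ki).
  have := Ospan_lin (- q) (mem1 j (ltn_ord j)) (mem1 i (ltn_ord i)).
  rewrite !s1E eqxx (inj_eq val_inj) (negPf ji) rmorphN scaleNr.
  by rewrite addrC addrK.
have rel1 : \sum_(k < size s) emb (c1 k) *: s1`_k = 0.
  rewrite -[RHS]rel (bigD1 i) // (bigD1 j) // [RHS](bigD1 i) //.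
  rewrite [X in _ = _ + X](bigD1 j) //= /c1 !s1E !eqxx !(inj_eq val_inj).
  rewrite (negPf ij) (negPf ji) !addrA; congr (_ + _).
    rewrite embB embM scalerDr scalerBl !scalerA [emb q * _]mulrC.
    by rewrite -addrA [X in _ + X]addrC subrK.
  apply: eq_bigr => k /andP[ki kj]; rewrite s1E !(inj_eq val_inj).
  by rewrite (negPf ki) (negPf kj).
have sum1 : (\sum_(k < size s) absz (qnorm (c1 k)) < m)%N.
  apply: leq_trans lt_m; rewrite (bigD1 j) //= [X in (_ < X)%N](bigD1 j) //=.
  rewrite -addSn leq_add //; last first.
    by apply: leq_sum => k kj; rewrite /c1 (inj_eq val_inj) (negPf kj).
  rewrite /c1 eqxx; apply: leq_trans (imin j cj).
  by have := qnorm_ge0 (c j - q * c i); lia.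
have ex1 : exists k : 'I_(size s), c1 k != 0.
  by exists i; rewrite /c1 (inj_eq val_inj) (negPf ij).
have := IHm s1 c1; rewrite size1 => /(_ sum1 rel1 ex1)[s' lt spanE].
by exists s' => // x; rewrite spanE span1.
Qed.

Lemma free_Oindependent (V : vectType E) (s : seq V) : free s -> Oindependent s.
Proof. by move=> /(@freeP _ _ _ (in_tuple s)) h c _ /h. Qed.

Lemma dependent_relation (V : vectType E) (s : seq V) : ~~ free s ->
  exists k : 'I_(size s) -> E, \sum_i k i *: s`_i = 0 /\ exists i, k i != 0.
Proof.
elim: s => [|v s IHs]; first by rewrite nil_free.
rewrite free_cons negb_and negbK => /orP[vs|/IHs[k [rel [i ki]]]].
  exists (fun i => if unlift ord0 i is Some j then - coord (in_tuple s) j v else 1).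
  split; last by exists ord0; rewrite unlift_none oner_eq0.
  rewrite big_ord_recl unlift_none scale1r {1}(@coord_span _ _ _ (in_tuple s) v vs).
  rewrite -big_split big1 // => i _.
  by rewrite /= liftK scaleNr addrN.
exists (fun i => if unlift ord0 i is Some j then k j else 0).
split; last by exists (lift ord0 i); rewrite liftK.
rewrite big_ord_recl unlift_none scale0r add0r -[RHS]rel.
by apply: eq_bigr => j _; rewrite liftK.
Qed.

Lemma Obasis_exists (V : vectType E) (s : seq V) :
  exists2 v, free v & forall x, Ospan v x <-> Ospan s x.
Proof.
have [n] := ubnP (size s); elim: n s => // n IHn s /ltnSE le_n.
have [fs|/dependent_relation[k [rel [i ki]]]] := boolP (free s); first by exists s.
have [d [a [d0 aE]]] := common_denominator k.
pose c m := if insub m is Some j then a j else 0.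
have cE (j : 'I_(size s)) : c j = a j by rewrite /c valK.
have [||s' lt spanE] := @shorten_generators V s c.
- transitivity (emb d *: \sum_j k j *: s`_j); last by rewrite rel scaler0.
  by rewrite scaler_sumr; apply: eq_bigr => j _; rewrite cE -aE scalerA.
- by exists i; rewrite cE -emb_eq0 -aE mulf_neq0 // emb_eq0.
have [v fv vE] := IHn s' (leq_trans lt le_n).
by exists v => // x; rewrite vE.
Qed.

Lemma Ospan_span (V : vectType E) (s : seq V) x : Ospan s x -> x \in <<s>>%VS.
Proof.
case=> c _ ->; apply: rpred_sum => i _; apply: rpredZ.
by apply: memv_span; apply: mem_nth.
Qed.

Lemma eq_Ospan_span (V : vectType E) (s s' : seq V) :
  (forall x, Ospan s x <-> Ospan s' x) -> <<s>>%VS = <<s'>>%VS.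
Proof.
move=> h; apply/eqP; rewrite eqEsubv; apply/andP.
by split; apply/span_subvP => x xs; apply: Ospan_span; apply/h; apply: Ospan_mem.
Qed.

(** * Gram matrices of lattices of rank 2 *)

Lemma fixed_conj_int x : qconj x = x -> x = (qre x)%:~R.
Proof. by case: x => a b [_ h]; apply: quadP; rewrite quad_intr //=; lia. Qed.

Lemma hform_diag_int (l : hlattice) x : @in_lattice l x ->
  exists n : int, hform l x x = emb n%:~R.
Proof.
move=> xl; have [z zE] := OE_emb (hform_integral xl xl).
exists (qre z); rewrite -fixed_conj_int //; apply: emb_inj.
by rewrite emb_conj -zE [RHS]hermC mul1r.
Qed.

(** The determinant is positive because [c * v0 - b * v1], the projection of [v0]
    orthogonally to [v1] up to the factor [c], has norm [c] times it. *)
Lemma binary_gram (l : hlattice) (v0 v1 : ambient l) : positive_lattice l ->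
  @in_lattice l v0 -> @in_lattice l v1 -> free [:: v0; v1] ->
  exists t, [/\ positive2 t, hform l v0 v0 = emb (b11 t)%:~R,
    hform l v1 v1 = emb (b22 t)%:~R & hform l v0 v1 = emb (b12 t)].
Proof.
move=> pl v0l v1l; rewrite free_cons seq1_free span_seq1 => /andP[v01 v1n0].
have [a aE] := hform_diag_int v0l; have [c cE] := hform_diag_int v1l.
have [b bE] := OE_emb (hform_integral v0l v1l).
exists (Binary a c b); split=> //.
have v0n0 : v0 != 0 by apply: contraNneq v01 => ->; apply: mem0v.
have a0 : 0 < a.
  by have := pl v0 v0l v0n0; rewrite aE E_val_int ltr0z.
have c0 : 0 < c.
  by have := pl v1 v1l v1n0; rewrite cE E_val_int ltr0z.
split=> //; pose u := emb c%:~R *: v0 + (emb (- b) *: v1 + 0).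
have ul : @in_lattice l u by do 2!apply: Ospan_lin => //; apply: Ospan0.
have cE0 : emb c%:~R != 0.
  by rewrite emb_eq0 quad_intr; apply/eqP => -[] c00; rewrite c00 in c0.
have un0 : u != 0.
  apply: contraNneq v01 => /eqP; rewrite /u addr0 rmorphN scaleNr subr_eq0 => /eqP e.
  apply/vlineP; exists ((emb c%:~R)^-1 * emb b).
  by rewrite -scalerA -e scalerA mulVf // scale1r.
have huu : hform l u u = emb (c * det2 (Binary a c b))%:~R.
  have cbE : hform l v1 v0 = emb (qconj b) by rewrite hermC mul1r bE emb_conj.
  rewrite /u addr0 linearDl !linearDr !linearZl_LR !linearZr_LR /=.
  rewrite aE cE bE cbE -!emb_conj -!embM -!embD; congr emb.
  by case: (b) => b1 b2; rewrite /det2; quad_ring.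
have := pl u ul un0; rewrite huu E_val_int ltr0z /= => h.
by rewrite -(pmulr_rgt0 _ c0).
Qed.

(** * The standard lattice *)

Definition std_basis : seq 'rV[E]_3 :=
  [:: delta_mx 0 0; delta_mx 0 1; delta_mx 0 2].

Lemma std_basisE : diag_gens [:: 1; 1; 1] = std_basis.
Proof.
rewrite /diag_gens /std_basis; change (size [:: 1; 1; 1 : int]) with 3%N.
rewrite !enum_ordSl enum_ord0 /=.
by congr [:: delta_mx 0 _; delta_mx 0 _; delta_mx 0 _]; apply: val_inj.
Qed.

Lemma gram_std_basis : @gram (diag_lattice [:: 1; 1; 1]) std_basis = 1%:M.
Proof.
apply/matrixP => i j; rewrite !mxE /=.
have nthE (k : 'I_3) : std_basis`_k = delta_mx 0 k.
  by case: k => [[|[|[|//]]] lt]; congr (delta_mx 0 _); apply: val_inj.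
rewrite (nthE i) (nthE j) /diag_form formee /diag_gram !mxE.
by case: i => [[|[|[|//]]] lt]; rewrite /= ?rmorph1.
Qed.

Lemma std_lattice_positive : positive_lattice (diag_lattice [:: 1; 1; 1]).
Proof.
move=> v _ v0.
have entry (i : 'I_3) :
    E_val (([:: 1; 1; 1]`_i)%:~R * v 0 i * conjE (v 0 i)) = `|E_val (v 0 i)| ^+ 2.
  have -> : [:: 1; 1; 1 : int]`_i = 1 by case: i => [[|[|[|//]]] lt].
  by rewrite mul1r normCK.
have -> : E_val (hform (diag_lattice [:: 1; 1; 1]) v v)
    = \sum_(i < 3) `|E_val (v 0 i)| ^+ 2.
  by rewrite /= diag_formE rmorph_sum; apply: eq_bigr => i _; apply: entry.
rewrite lt_def sumr_ge0 ?andbT; last by move=> i _; apply: exprn_ge0.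
apply: contra v0; rewrite psumr_eq0 => [/allP h|i _]; last exact: exprn_ge0.
apply/eqP/rowP => i; rewrite mxE; apply: E_val_inj; apply/eqP.
by have := h i (mem_index_enum _); rewrite /= expf_eq0 normr_eq0.
Qed.

Theorem theorem4 : two_universal (diag_lattice [:: 1; 1; 1]).
Proof.
split=> [|l rank_l pl]; first exact: std_lattice_positive.
have [v fv spanv] := Obasis_exists (gens l).
have size_v : size v = 2%N.
  by rewrite -rank_l /lrank -(eq_Ospan_span spanv); apply/esym/eqP.
case: v size_v fv spanv => [|v0 [|v1 []]] //= _ fv spanv.
have v0l : @in_lattice l v0 by apply/spanv/Ospan_mem; rewrite inE eqxx.
have v1l : @in_lattice l v1 by apply/spanv/Ospan_mem; rewrite !inE eqxx orbT.
have [t [pt h00 h11 h01]] := binary_gram pl v0l v1l fv.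
have [X XE] := positive2_represented pt.
exists std_basis, [:: v0; v1], (map_mx emb X : 'M_(2, 3)); split.
- by rewrite -std_basisE; apply: diag_lattice_basis.
- by split=> //; apply: free_Oindependent.
- by apply/mxOverP => i j; rewrite mxE emb_OE.
have gramE : @gram l [:: v0; v1] = map_mx emb (gram2 t).
  apply/matrixP => i j; rewrite !mxE.
  case: i j => [[|[|//]] ?] [[|[|//]] ?]; [exact: h00 | exact: h01 | | exact: h11].
  have h10 : hform l v1 v0 = emb (qconj (b12 t)) by rewrite emb_conj -h01 hermC mul1r.
  exact: h10.
rewrite gramE XE gram_std_basis !map_mxM map_mx1; congr (_ *m _ *m _).
apply/matrixP => i j; rewrite /adj !mxE; exact: emb_conj.
Qed.
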